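(* Let $u:(M,g,\nabla^M)\to(N,h,\nabla^N)$ be a statistical biharmonic map between statistical manifolds, where $(N,h,\nabla^N)$ is of constant sectional curvature $\lambda\in\mathbb R$. Assume that there exists a relatively compact domain $\Omega\subset M$ such that $\tau(u)\in\Gamma_\Omega(u^{-1}TN)$, that $$\Delta^u\tau(u)+\sum_{i=1}^mR^N(\tau(u),u_*e_i)u_*e_i-2K^N_{\tau(u)}\tau(u)=0,$$ and that there exists a constant $C>0$ such that $$4\lambda\,\|\tau(u)\|_h^2\,h(\tau(u),\widehat\tau(u))+h\big((\overline\nabla^N_{\tau(u)}K^N)(\tau(u),\tau(u)),\tau(u)\big)\ \ge\ C\,\|\tau(u)\|_h^4,$$ where $\widehat\tau(u)$ is the tension field of $u:(M,g,\nabla^g)\to(N,\nabla^h)$ with respect to the Levi-Civita connections $\nabla^g,\nabla^h$. If $\langle u_*X,\tau(u)\rangle=0$ for every $X\in\Gamma(TM)$, then $u$ is weakly stable if and only if $\tau(u)=0$.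
   Context: All objects are smooth; $M$ is orientable, $m=\dim M$. A statistical manifold $(M,g,\nabla)$ is a Riemannian manifold with a torsion-free affine connection such that $(\nabla_Xg)(Y,Z)=(\nabla_Yg)(X,Z)$. $\nabla^g$ is the Levi-Civita connection. The difference tensor is $K_XY=K(X,Y)=\nabla_XY-\nabla^g_XY$, the Tchebychev vector field is $T=\mathrm{tr}_gK$. The conjugate connection $\overline\nabla$ is defined by $Xg(Y,Z)=g(\nabla_XY,Z)+g(Y,\overline\nabla_XZ)$. Curvature: $R(X,Y)Z=\nabla_X\nabla_YZ-\nabla_Y\nabla_XZ-\nabla_{[X,Y]}Z$; $\overline R$ is the curvature of $\overline\nabla$. The statistical manifold has constant sectional curvature $\lambda$ if $R(X,Y)Z=\lambda(g(Y,Z)X-g(X,Z)Y)$. The tensor $L$ is defined by $g(L(Z,W)X,Y)=g(R(X,Y)Z,W)$, and $\bar L$ is the same tensor built from $\overline R$. Superscripts $M,N$ indicate the manifold. For a smooth map $u:(M,g,\nabla^M)\to(N,h,\nabla^N)$ between statistical manifolds, $\nabla^u$ and $\overline\nabla^u$ are the connections on $u^{-1}TN$ induced from $\nabla^N$ and $\overline\nabla^N$, and $\langle\cdot,\cdot\rangle$ is the fiber metric induced by $h$. With $\{e_i\}$ a local $g$-orthonormal frame: the tension field is $\tau(u)=\sum_i(\nabla^u_{e_i}u_*e_i-u_*\nabla^M_{e_i}e_i)$; $\overline\tau(u)=\sum_i(\overline\nabla^u_{e_i}u_*e_i-u_*\overline\nabla^M_{e_i}e_i)$ (and $\widehat\tau(u)$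 is the analogous expression with Levi-Civita connections); $\Delta^uV=\sum_i(\nabla^u_{e_i}\nabla^u_{e_i}V-\nabla^u_{\nabla^M_{e_i}e_i}V)$; $\bar\Delta^uV=\sum_i(\overline\nabla^u_{e_i}\overline\nabla^u_{e_i}V-\overline\nabla^u_{\overline\nabla^M_{e_i}e_i}V)$; $\tau_2(u)=\bar\Delta^u\tau(u)+\operatorname{div}^g(T^M)\tau(u)-\sum_iL^N(u_*e_i,\tau(u))u_*e_i-K^N(\tau(u),\tau(u))$. The map $u$ is statistical biharmonic if $\tau_2(u)=0$. Put $$\begin{aligned}\mathcal H_u(V)=&\ \overline R^N(V,\overline\tau(u))\tau(u)+\sum_i(\overline\nabla^N_{u_*e_i}\overline R^N)(V,u_*e_i)\tau(u)+2\sum_i\overline R^N(V,u_*e_i)\overline\nabla^u_{e_i}\tau(u)\\&+\sum_i(\overline\nabla^N_V\bar L^N)(\tau(u),u_*e_i)u_*e_i-2\sum_iL^N(u_*e_i,\tau(u))\overline\nabla^u_{e_i}V-(\overline\nabla^N_VK^N)(\tau(u),\tau(u)).\end{aligned}$$ For a relatively compact domain $\Omega\subset M$ (connected, open, compact closure) let $\Gamma_\Omega(u^{-1}TN)$ be the sections with compact support in $\Omega$. A statistical biharmonic map $u$ is weakly stable if for every relatively compact domain $\Omega\subset M$ and every $V\in\Gamma_\Omega(u^{-1}TN)$, $$\int_\Omega\Big\|\Delta^uV+\sum_iR^N(V,u_*e_i)u_*e_i-2K^N_{\tau(u)}V\Big\|_h^2d\mu_g+\int_\Omega\langle\mathcal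 H_u(V),V\rangle d\mu_g\ge0 .$$ *)

(* Defs.v *)
From HB Require Import structures.
From mathcomp Require Import all_boot all_order all_algebra.
From mathcomp Require Import all_classical all_reals all_analysis.

Set Implicit Arguments.
Unset Strict Implicit.
Unset Printing Implicit Defensive.

Import Order.TTheory GRing.Theory Num.Theory.
Import numFieldNormedType.Exports.

Local Open Scope classical_set_scope.
Local Open Scope ring_scope.

(* f is C^oo on the open set D: all iterated directional derivatives of f are
   (Frechet) differentiable, hence continuous, at every point of D. *)
Definition smooth_on (R : realType) (V W : normedModType R) (D : set V)
    (f : V -> W) : Prop :=
  forall (s : seq V) (x : V), D x ->
    differentiable (foldr (fun v (g : V -> W) => fun y => 'D_v g y) f s) x.

(* [cinv c] is only meaningful on the image of [cdom c] under [cmap c]. *)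
Record chart (R : realType) (T : ptopologicalType) (m : nat) := Chart {
  cdom : set T;
  cmap : T -> 'rV[R]_m;
  cinv : 'rV[R]_m -> T }.

Definition is_chart (R : realType) (T : ptopologicalType) (m : nat)
    (c : chart R T m) : Prop :=
  [/\ open (cdom c), open (cmap c @` cdom c),
      forall p, cdom c p -> cinv c (cmap c p) = p,
      forall p, cdom c p -> {for p, continuous (cmap c)} &
      forall p, cdom c p -> {for cmap c p, continuous (cinv c)}].

Definition smooth_transition (R : realType) (T : ptopologicalType) (m : nat)
    (c d : chart R T m) : Prop :=
  smooth_on (cmap c @` (cdom c `&` cdom d)) (cmap d \o cinv c).

(* [chart_at p] is an arbitrary preferred chart around p, used to name tangent
   vectors: the tangent space at p is represented by 'rV[R]_m, the row v
   standing for the tangent vector whose components in [chart_at p] are v. *)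
Record manifold (R : realType) (m : nat) := Manifold {
  carrier :> ptopologicalType;
  manifold_hausdorff : hausdorff_space carrier;
  manifold_countable : @second_countable carrier;
  atlas : set (chart R carrier m);
  atlas_chart : forall c, atlas c -> is_chart c;
  atlas_compat : forall c d, atlas c -> atlas d -> smooth_transition c d;
  chart_at : carrier -> chart R carrier m;
  chart_at_atlas : forall p, atlas (chart_at p);
  chart_at_mem : forall p, cdom (chart_at p) p }.

Definition orientable (R : realType) (m : nat) (M : manifold R m) : Prop :=
  exists O : set (chart R M m),
    [/\ forall c, O c -> is_chart c /\
          (forall d, atlas d -> smooth_transition c d /\ smooth_transition d c),
        forall p, exists2 c, O c & cdom c p &
        forall c d p, O c -> O d -> cdom c p -> cdom d p ->
          0 < \det (jacobian (cmap d \o cinv c) (cmap c p))].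

(* The derivative v(f) of f at p along the tangent vector v at p. *)
Definition dirder (R : realType) (m : nat) (M : manifold R m)
    (W : normedModType R) (f : M -> W) (p : M) (v : 'rV[R]_m) : W :=
  'D_v (f \o cinv (chart_at p)) (cmap (chart_at p) p).

(* Components of v in the chart c. *)
Definition tcoord (R : realType) (m : nat) (M : manifold R m)
    (c : chart R M m) (p : M) (v : 'rV[R]_m) : 'rV[R]_m :=
  dirder (cmap c) p v.

(* The vector field on [cdom c] with constant components w in the chart c. *)
Definition cfield (R : realType) (m : nat) (M : manifold R m)
    (c : chart R M m) (w : 'rV[R]_m) (q : M) : 'rV[R]_m :=
  'D_w (cmap (chart_at q) \o cinv c) (cmap c q).

(* A vector field extending the tangent vector v at p to a neighbourhood of p:
   the constant one in [chart_at p]. *)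
Definition ext (R : realType) (m : nat) (M : manifold R m)
    (p : M) (v : 'rV[R]_m) : M -> 'rV[R]_m := cfield (chart_at p) v.

Definition fsmooth_on (R : realType) (m : nat) (M : manifold R m)
    (W : normedModType R) (U : set M) (f : M -> W) : Prop :=
  forall c : chart R M m, atlas c ->
    smooth_on (cmap c @` (U `&` cdom c)) (f \o cinv c).

Definition smooth_map (R : realType) (m n : nat) (M : manifold R m)
    (N : manifold R n) (u : M -> N) : Prop :=
  continuous u /\
  forall (c : chart R M m) (d : chart R N n), atlas c -> atlas d ->
    smooth_on (cmap c @` (cdom c `&` u @^-1` cdom d))
              (cmap d \o u \o cinv c).

(* The differential u_* at p. *)
Definition tmap (R : realType) (m n : nat) (M : manifold R m)
    (N : manifold R n) (u : M -> N) (p : M) (v : 'rV[R]_m) : 'rV[R]_n :=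
  dirder (cmap (chart_at (u p)) \o u) p v.

(* A section of u^{-1}TN is a function V with V p a tangent vector at u p. *)
Definition ssmooth_on (R : realType) (m n : nat) (M : manifold R m)
    (N : manifold R n) (u : M -> N) (U : set M) (V : M -> 'rV[R]_n) : Prop :=
  forall (c : chart R M m) (d : chart R N n), atlas c -> atlas d ->
    smooth_on (cmap c @` (U `&` cdom c `&` u @^-1` cdom d))
              ((fun q => tcoord d (u q) (V q)) \o cinv c).

Definition vsmooth_on (R : realType) (m : nat) (M : manifold R m)
    (U : set M) (X : M -> 'rV[R]_m) : Prop :=
  ssmooth_on (fun q : M => q) U X.

Definition fsmooth_near (R : realType) (m : nat) (M : manifold R m)
    (p : M) (f : M -> R) : Prop :=
  exists2 U : set M, open_nbhs p U & fsmooth_on U (f : M -> R^o).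

Definition vsmooth_near (R : realType) (m : nat) (M : manifold R m)
    (p : M) (X : M -> 'rV[R]_m) : Prop :=
  exists2 U : set M, open_nbhs p U & vsmooth_on U X.

Definition dirderR (R : realType) (m : nat) (M : manifold R m)
    (f : M -> R) (p : M) (v : 'rV[R]_m) : R :=
  dirder (f : M -> R^o) p v.

Definition riemannian (R : realType) (m : nat) (M : manifold R m)
    (g : M -> 'rV[R]_m -> 'rV[R]_m -> R) : Prop :=
  [/\ forall p a v v' w, g p (a *: v + v') w = a * g p v w + g p v' w,
      forall p v w, g p v w = g p w v,
      forall p v, v != 0 -> 0 < g p v v &
      forall (U : set M) X Y, open U -> vsmooth_on U X -> vsmooth_on U Y ->
        fsmooth_on U ((fun q => g q (X q) (Y q)) : M -> R^o)].

(* [nab p v Y] is the covariant derivative of the field Y at p along the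
   tangent vector v at p; it is constrained only for Y smooth near p. Since
   the rules hold for Y and f smooth merely near p (f may be the indicator of
   a neighbourhood of p), [nab p v Y] depends only on the germ of Y at p. *)
Definition covder (R : realType) (m : nat) (M : manifold R m) : Type :=
  M -> 'rV[R]_m -> (M -> 'rV[R]_m) -> 'rV[R]_m.

Definition affine_connection (R : realType) (m : nat) (M : manifold R m)
    (nab : covder M) : Prop :=
  [/\ forall p a v w Y, vsmooth_near p Y ->
        nab p (a *: v + w) Y = a *: nab p v Y + nab p w Y,
      forall p v Y Z, vsmooth_near p Y -> vsmooth_near p Z ->
        nab p v (fun q => Y q + Z q) = nab p v Y + nab p v Z,
      forall p v f Y, fsmooth_near p f -> vsmooth_near p Y ->
        nab p v (fun q => f q *: Y q)
        = dirderR f p v *: Y p + f p *: nab p v Y &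
      forall (U : set M) X Y, open U -> vsmooth_on U X -> vsmooth_on U Y ->
        vsmooth_on U (fun q => nab q (X q) Y)].

(* Lie bracket, computed in the chart [chart_at p]. *)
Definition lie (R : realType) (m : nat) (M : manifold R m)
    (X Y : M -> 'rV[R]_m) (p : M) : 'rV[R]_m :=
  dirder (fun q => tcoord (chart_at p) q (Y q)) p (X p)
  - dirder (fun q => tcoord (chart_at p) q (X q)) p (Y p).

Definition torsion_free (R : realType) (m : nat) (M : manifold R m)
    (nab : covder M) : Prop :=
  forall p X Y, vsmooth_near p X -> vsmooth_near p Y ->
    nab p (X p) Y - nab p (Y p) X = lie X Y p.

Definition conjugate (R : realType) (m : nat) (M : manifold R m)
    (g : M -> 'rV[R]_m -> 'rV[R]_m -> R) (nab nab' : covder M) : Prop :=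
  forall p v Y Z, vsmooth_near p Y -> vsmooth_near p Z ->
    dirderR (fun q => g q (Y q) (Z q)) p v
    = g p (nab p v Y) (Z p) + g p (Y p) (nab' p v Z).

(* (nab_v g)(Y, Z) *)
Definition nabla_metric (R : realType) (m : nat) (M : manifold R m)
    (g : M -> 'rV[R]_m -> 'rV[R]_m -> R) (nab : covder M)
    (p : M) (v : 'rV[R]_m) (Y Z : M -> 'rV[R]_m) : R :=
  dirderR (fun q => g q (Y q) (Z q)) p v
  - g p (nab p v Y) (Z p) - g p (Y p) (nab p v Z).

(* The conjugate connection [cnab] and the Levi-Civita connection [lc] exist
   and are uniquely determined by [met] and [nab] through the fields
   that follow them; bundling them adds
   no structure. *)
Record statManifold (R : realType) (m : nat) := StatManifold {
  sm_manifold :> manifold R m;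
  met : sm_manifold -> 'rV[R]_m -> 'rV[R]_m -> R;
  met_riemannian : riemannian met;
  nab : covder sm_manifold;
  nab_connection : affine_connection nab;
  nab_torsion_free : torsion_free nab;
  nab_codazzi : forall p X Y Z,
    vsmooth_near p X -> vsmooth_near p Y -> vsmooth_near p Z ->
    nabla_metric met nab p (X p) Y Z = nabla_metric met nab p (Y p) X Z;
  cnab : covder sm_manifold;
  cnab_connection : affine_connection cnab;
  cnab_conjugate : conjugate met nab cnab;
  lc : covder sm_manifold;
  lc_connection : affine_connection lc;
  lc_torsion_free : torsion_free lc;
  lc_metric : forall p v Y Z, vsmooth_near p Y -> vsmooth_near p Z ->
    nabla_metric met lc p v Y Z = 0 }.

(* A local g-orthonormal frame around p; such frames exist, and the default
   value of [xget] is never used. *)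
Definition frame (R : realType) (m : nat) (M : statManifold R m)
    (p : M) : 'I_m -> M -> 'rV[R]_m :=
  xget (fun _ _ => 0)
    [set e : 'I_m -> M -> 'rV[R]_m | exists2 U : set M, open_nbhs p U &
      (forall i, vsmooth_on U (e i)) /\
      (forall q i j, U q -> met q (e i q) (e j q) = (i == j)%:R)].

Definition curvature (R : realType) (m : nat) (M : manifold R m)
    (D : covder M) (X Y Z : M -> 'rV[R]_m) (p : M) : 'rV[R]_m :=
  D p (X p) (fun q => D q (Y q) Z) - D p (Y p) (fun q => D q (X q) Z)
  - D p (lie X Y p) Z.

(* R(x, y)z as a tensor on tangent vectors at p. *)
Definition Rten (R : realType) (m : nat) (M : manifold R m)
    (D : covder M) (p : M) (x y z : 'rV[R]_m) : 'rV[R]_m :=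
  curvature D (ext p x) (ext p y) (ext p z) p.

(* L(z, w)x: the vector l with g(l, y) = g(R(x, y)z, w) for all y, where R is
   the curvature of D. *)
Definition Lten (R : realType) (m : nat) (M : statManifold R m)
    (D : covder M) (p : M) (z w x : 'rV[R]_m) : 'rV[R]_m :=
  xget 0 [set l : 'rV[R]_m |
    forall y, met p l y = met p (Rten D p x y z) w].

Definition Kten (R : realType) (m : nat) (M : statManifold R m)
    (p : M) (x y : 'rV[R]_m) : 'rV[R]_m :=
  nab p x (ext p y) - lc p x (ext p y).

Definition tchebychev (R : realType) (m : nat) (M : statManifold R m)
    (p : M) : 'rV[R]_m :=
  \sum_i Kten p (frame p i p) (frame p i p).

Definition divg (R : realType) (m : nat) (M : statManifold R m)
    (X : M -> 'rV[R]_m) (p : M) : R :=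
  \sum_i met p (lc p (frame p i p) X) (frame p i p).

Definition constant_curvature (R : realType) (m : nat) (M : statManifold R m)
    (lambda : R) : Prop :=
  forall (p : M) x y z,
    Rten (@nab R m M) p x y z
    = lambda *: (met p y z *: x - met p x z *: y).

(* Covariant derivatives (D_v B)(x, y) and (D_v B)(x, y, z) of tensor fields B
   of type (1,2) and (1,3), by the Leibniz rule. *)
Definition nabla2 (R : realType) (m : nat) (M : manifold R m) (D : covder M)
    (B : M -> 'rV[R]_m -> 'rV[R]_m -> 'rV[R]_m)
    (p : M) (v x y : 'rV[R]_m) : 'rV[R]_m :=
  D p v (fun q => B q (ext p x q) (ext p y q))
  - B p (D p v (ext p x)) y - B p x (D p v (ext p y)).

Definition nabla3 (R : realType) (m : nat) (M : manifold R m) (D : covder M)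
    (B : M -> 'rV[R]_m -> 'rV[R]_m -> 'rV[R]_m -> 'rV[R]_m)
    (p : M) (v x y z : 'rV[R]_m) : 'rV[R]_m :=
  D p v (fun q => B q (ext p x q) (ext p y q) (ext p z q))
  - B p (D p v (ext p x)) y z - B p x (D p v (ext p y)) z
  - B p x y (D p v (ext p z)).

(* The connection induced by DN on u^{-1}TN, at p along v: writing
   V = sum_k V^k (d_k o u) in the coordinate frame d_k of [chart_at (u p)],
   it is sum_k (v(V^k) d_k + V^k DN_{u_* v} d_k). *)
Definition pull (R : realType) (m n : nat) (M : manifold R m)
    (N : manifold R n) (DN : covder N) (u : M -> N)
    (p : M) (v : 'rV[R]_m) (V : M -> 'rV[R]_n) : 'rV[R]_n :=
  dirder (fun q => tcoord (chart_at (u p)) (u q) (V q)) p v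
  + DN (u p) (tmap u p v) (ext (u p) (V p)).

Definition tension (R : realType) (m n : nat) (M : statManifold R m)
    (N : manifold R n) (DM : covder M) (DN : covder N) (u : M -> N)
    (p : M) : 'rV[R]_n :=
  let e := frame p in
  \sum_i (pull DN u p (e i p) (fun q => tmap u q (e i q))
          - tmap u p (DM p (e i p) (e i))).

Definition laplacian (R : realType) (m n : nat) (M : statManifold R m)
    (N : manifold R n) (DM : covder M) (DN : covder N) (u : M -> N)
    (V : M -> 'rV[R]_n) (p : M) : 'rV[R]_n :=
  let e := frame p in
  \sum_i (pull DN u p (e i p) (fun q => pull DN u q (e i q) V)
          - pull DN u p (DM p (e i p) (e i)) V).

Section StatisticalMaps.
Context (R : realType) (m n : nat) (M : statManifold R m)
  (N : statManifold R n).

Implicit Types (u : M -> N) (V : M -> 'rV[R]_n).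

Definition tau u : M -> 'rV[R]_n := tension (@nab R m M) (@nab R n N) u.
Definition ctau u : M -> 'rV[R]_n := tension (@cnab R m M) (@cnab R n N) u.
Definition lctau u : M -> 'rV[R]_n := tension (@lc R m M) (@lc R n N) u.

Definition Lap u V : M -> 'rV[R]_n := laplacian (@nab R m M) (@nab R n N) u V.
Definition cLap u V : M -> 'rV[R]_n :=
  laplacian (@cnab R m M) (@cnab R n N) u V.

Definition tau2 u (p : M) : 'rV[R]_n :=
  let t := tau u p in
  let ue := fun i => tmap u p (frame p i p) in
  cLap u (tau u) p + divg (@tchebychev R m M) p *: t
  - \sum_i Lten (@nab R n N) (u p) (ue i) t (ue i) - Kten (u p) t t.

Definition statistical_biharmonic u : Prop := forall p, tau2 u p = 0.

Definition jacobi u V (p : M) : 'rV[R]_n :=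
  let ue := fun i => tmap u p (frame p i p) in
  Lap u V p + \sum_i Rten (@nab R n N) (u p) (V p) (ue i) (ue i)
  - 2 *: Kten (u p) (tau u p) (V p).

(* [Rb], [Lb] are the tensors R, L of the conjugate connection of N. *)
Definition Hop u V (p : M) : 'rV[R]_n :=
  let e := frame p in
  let ue := fun i => tmap u p (e i p) in
  let y := u p in
  let t := tau u p in
  let v := V p in
  let RN := Rten (@nab R n N) in
  let Rb := Rten (@cnab R n N) in
  let LN := Lten (@nab R n N) in
  let Lb := Lten (@cnab R n N) in
  Rb y v (ctau u p) t
  + \sum_i nabla3 (@cnab R n N) Rb y (ue i) v (ue i) t
  + 2 *: \sum_i Rb y v (ue i) (pull (@cnab R n N) u p (e i p) (tau u))
  + \sum_i nabla3 (@cnab R n N) Lb y v t (ue i) (ue i)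
  - 2 *: \sum_i LN y (ue i) t (pull (@cnab R n N) u p (e i p) V)
  - nabla2 (@cnab R n N) (@Kten R n N) y v t t.

End StatisticalMaps.

Definition borel (T : ptopologicalType) := g_sigma_algebraType (@open T).

(* Lebesgue measure on R^m, as the Borel measure with the right value on
   closed boxes. *)
Definition is_lebesgue (R : realType) (m : nat)
    (leb : {measure set (borel 'rV[R]_m) -> \bar R}) : Prop :=
  forall a b : 'rV[R]_m, (forall i, a ord0 i <= b ord0 i) ->
    leb [set x : 'rV[R]_m | forall i, a ord0 i <= x ord0 i <= b ord0 i]
    = (\prod_i (b ord0 i - a ord0 i))%:E.

Definition gram (R : realType) (m : nat) (M : statManifold R m)
    (c : chart R M m) (q : M) : 'M[R]_m :=
  \matrix_(i, j) met q (cfield c (delta_mx ord0 i) q)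
                       (cfield c (delta_mx ord0 j) q).

(* mu is mu_g, i.e. sqrt(det(g_ij)) dx in every chart. *)
Definition is_riemannian_measure (R : realType) (m : nat)
    (M : statManifold R m) (mu : {measure set (borel M) -> \bar R}) : Prop :=
  exists2 leb : {measure set (borel 'rV[R]_m) -> \bar R}, is_lebesgue leb &
    forall (c : chart R M m) (A : set (borel M)), atlas c ->
      measurable A -> A `<=` cdom c ->
      mu A = (\int[leb]_(x in (cmap c @` A : set (borel 'rV[R]_m)))
               (Num.sqrt (\det (gram c (cinv c x))))%:E)%E.

Definition relatively_compact_domain (T : ptopologicalType) (Omega : set T) :=
  [/\ connected Omega, open Omega & compact (closure Omega)].

(* The space Gamma_Omega of smooth sections of u^{-1}TN with compact support
   in Omega. *)
Definition compact_section (R : realType) (m n : nat) (M : manifold R m)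
    (N : manifold R n) (Omega : set M) (u : M -> N) (V : M -> 'rV[R]_n) :=
  [/\ ssmooth_on u [set: M] V,
      compact (closure [set p | V p != 0]) &
      closure [set p | V p != 0] `<=` Omega].

Definition weakly_stable (R : realType) (m n : nat) (M : statManifold R m)
    (N : statManifold R n) (mu : {measure set (borel M) -> \bar R})
    (u : M -> N) : Prop :=
  forall (Omega : set M) (V : M -> 'rV[R]_n),
    relatively_compact_domain Omega -> compact_section Omega u V ->
    (0 <= \int[mu]_(p in (Omega : set (borel M)))
            (met (u p) (jacobi u V p) (jacobi u V p))%:E
          + \int[mu]_(p in (Omega : set (borel M)))
            (met (u p) (Hop u V p) (V p))%:E)%E.

(* Main.v *)
Require Import Defs.
From mathcomp Require Import all_boot all_order all_algebra.
From mathcomp Require Import all_classical all_reals all_analysis.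
From mathcomp Require Import ring lra perm.
Import Order.TTheory GRing.Theory Num.Theory.
Import numFieldNormedType.Exports.
Local Open Scope classical_set_scope.
Local Open Scope ring_scope.

(** Stability is tested against the tension field itself. Write t = tau(u),
    u_i = u_* e_i, and bars for the conjugate connection. The hypothesis on the
    Jacobi operator removes the square from the second variation at V = t, so
    weak stability says that the integral of <H(t), t> is nonnegative, and the
    point is that the hypotheses make <H(t), t> <= - C |t|^4.

    This is a pointwise computation ([Hop_tau]). The curvatures of a pair of
    conjugate connections are dual ([Rten_dual]), so constant curvature lambda
    turns the curvature of the conjugate connection, and the tensors L of both,
    into the one algebraic tensor lambda (<y, z> x - <x, z> y) ([Rten_cnab],
    [Lten_cst]). Its conjugate covariant derivative only sees the derivative of
    the metric, which is twice the cubic form C(x, y, z) = <K(x, y), z>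
    ([nabla3_cst]). As t is orthogonal to every u_i, what remains of
    <H(t), t> is
      4 lambda |t|^2 (sum_i C(u_i, u_i, t) + sum_i <u_i, Dbar_i t>)
        - <(nablabar_t K)(t, t), t>.
    Differentiating <u_i, t> = 0 by the product rule along u ([pull_metric])
    gives sum_i <u_i, Dbar_i t> = - |t|^2, and comparing the connection of N
    with its Levi-Civita connection gives
    sum_i C(u_i, u_i, t) = |t|^2 - <t, hat tau>. The pinching inequality is the
    resulting bound.

    If t is nonzero at a point, continuity keeps <H(t), t> below a negative
    constant near it, and a nonempty open set has positive Riemannian measure
    ([riemannian_measure_open]): the integral is negative, a contradiction.
    Conversely, t = 0 kills every term of H ([Hop_zero]) and only the integral
    of a square is left.

    Three facts of analysis support this: iterated derivatives are controlled
    by a coinduction principle ([smooth_on_coind]); mixed second derivatives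
    commute ([schwarz]), which gives the duality of curvatures; and a tangent
    vector extends to a global field ([vector_extension]), because normality is
    assumed against global fields only but used pointwise. *)

Set Implicit Arguments.
Unset Strict Implicit.
Unset Printing Implicit Defensive.

(** * Smooth functions on open sets *)

Lemma near_eq_diff_axiom (R : realType) (V W : normedModType R) (f g : V -> W)
  (x : V) : (\near x, f x = g x) -> differentiable f x ->
  g \o shift x = cst (g x) + 'd f x +o_ 0 id.
Proof.
move=> fg df; have /diff_locally := df => /eqaddoP dfx; apply/eqaddoP => e e0.
have fgx : f x = g x := nbhs_singleton fg.
have : \forall h \near 0, f (h + x) = g (h + x).
  by move: fg; rewrite (near_shift 0) /=; apply: filterS => h; rewrite /= subr0.
move=> fg0; near=> h.
have -> : (g \o shift x - (cst (g x) + 'd f x)) h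
  = (f \o shift x - (cst (f x) + 'd f x)) h.
  rewrite !fctE /= fgx; congr (_ - _); apply/esym; near: h; exact: fg0.
by near: h; exact: dfx.
Unshelve. all: by end_near. Qed.

(** The differential is a chosen linear map, so local invariance goes through
    the uniqueness of first-order expansions. *)
Lemma near_eq_differentiable (R : realType) (V W : normedModType R)
  (f g : V -> W) (x : V) :
  (\near x, f x = g x) -> differentiable f x -> differentiable g x.
Proof.
move=> fg df; have gx := near_eq_diff_axiom fg df.
have dfc : continuous ('d f x) by exact: diff_continuous.
apply/diff_locallyP.
by rewrite (_ : 'd g x = 'd f x :> (V -> W)) //; apply: diff_unique.
Qed.

Section Smooth.
Context (R : realType).
Implicit Types (V W : normedModType R).

Local Notation iterD s f :=
  (foldr (fun v g => fun y => derive g y v) f s).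

Lemma smooth_on_diff V W (D : set V) (f : V -> W) x :
  smooth_on D f -> D x -> differentiable f x.
Proof. by move=> /(_ [::] x). Qed.

Lemma smooth_on_derive V W (D : set V) (f : V -> W) v :
  smooth_on D f -> smooth_on D (fun y => 'D_v f y).
Proof. by move=> sf s x Dx; have := sf (rcons s v) x Dx; rewrite foldr_rcons. Qed.

Lemma smooth_on_sub V W (D E : set V) (f : V -> W) :
  D `<=` E -> smooth_on E f -> smooth_on D f.
Proof. by move=> DE sf s x /DE; exact: sf. Qed.

Lemma iter_derive_ext V W (D : set V) (f g : V -> W) s : open D ->
  (forall x, D x -> f x = g x) -> forall x, D x -> iterD s f x = iterD s g x.
Proof.
move=> oD fg; elim: s => //= v s IH x Dx; apply: near_eq_derive.
by apply: (filterS IH); exact: open_nbhs_nbhs.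
Qed.

Lemma smooth_on_ext V W (D : set V) (f g : V -> W) : open D ->
  (forall x, D x -> f x = g x) -> smooth_on D f -> smooth_on D g.
Proof.
move=> oD fg sf s x Dx; apply: (near_eq_differentiable (f := iterD s f)).
  by apply: (filterS (iter_derive_ext s oD fg)); exact: open_nbhs_nbhs.
exact: sf.
Qed.

Lemma smooth_on_near V W (D : set V) (f : V -> W) :
  (forall x, D x -> exists2 E, open_nbhs x E & smooth_on E f) -> smooth_on D f.
Proof. by move=> sf s x /sf[E [_ Ex]]; apply. Qed.

(** Smoothness is the largest family of functions that are differentiable and
    closed under directional derivatives, up to equality on the open set [D].
    Products, compositions and the cut-off function below are shown to be
    smooth by exhibiting such a family. *)
Lemma smooth_on_coind V W (D : set V) (P : (V -> W) -> Prop) : open D ->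
  (forall f, P f -> forall x, D x -> differentiable f x) ->
  (forall f v, P f -> exists2 h, P h & forall x, D x -> 'D_v f x = h x) ->
  forall f, P f -> smooth_on D f.
Proof.
move=> oD Pd PD f Pf s; elim/last_ind: s f Pf => [|s v IH] f Pf x Dx /=.
  exact: Pd.
rewrite foldr_rcons; have [h Ph fh] := PD f v Pf.
apply: (near_eq_differentiable (f := iterD s h)); last exact: IH.
have hf y : D y -> h y = 'D_v f y by move=> Dy; rewrite fh.
by apply: (filterS (iter_derive_ext s oD hf)); exact: open_nbhs_nbhs.
Qed.

Lemma smooth_on_cst V W (D : set V) (a : W) : open D -> smooth_on D (cst a).
Proof.
move=> oD; apply: (smooth_on_coind (P := fun f => exists b, f = cst b)) => //.
- by move=> f [b ->] x _; exact: differentiable_cst.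
- move=> f v [b ->]; exists (cst 0); first by exists 0.
  by move=> x _; rewrite derive_cst.
- by exists a.
Qed.

Lemma smooth_on_lin V W W' (L : {linear W -> W'}) (D : set V) (f : V -> W) :
  open D -> continuous L -> smooth_on D f -> smooth_on D (L \o f).
Proof.
move=> oD cL sf.
apply: (smooth_on_coind (P := fun f => exists2 h, f = L \o h & smooth_on D h)) => //.
- move=> _ [h -> sh] x Dx; apply: differentiable_comp.
    exact: (smooth_on_diff sh).
  exact: linear_differentiable.
- move=> _ v [h -> sh]; exists (L \o (fun y => 'D_v h y)).
    by exists (fun y => 'D_v h y) => //; exact: smooth_on_derive.
  move=> x Dx; have dh := smooth_on_diff sh Dx.
  rewrite deriveE; last by apply: differentiable_comp => //; exact: linear_differentiable.
  rewrite diff_comp //; last exact: linear_differentiable.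
  by rewrite /= diff_lin // deriveE.
- by exists f.
Qed.

(** The shape that iterated derivatives of the generators [G] take by the
    Leibniz and chain rules. *)
Inductive smooth_span V (D : set V) (G : (V -> R) -> Prop) : (V -> R) -> Prop :=
| span_gen f : G f -> smooth_span D G f
| span_zero : smooth_span D G (cst 0)
| span_mul (a f : V -> R) : smooth_on D a -> smooth_span D G f ->
    smooth_span D G (fun x => a x * f x)
| span_add (f g : V -> R) : smooth_span D G f -> smooth_span D G g ->
    smooth_span D G (fun x => f x + g x).

Lemma span_sum V (D : set V) G (k : nat) (F : 'I_k -> V -> R) :
  (forall i, smooth_span D G (F i)) ->
  smooth_span D G (fun x => \sum_i F i x).
Proof.
elim: k F => [|k IH] F sF.
  by rewrite (_ : (fun x => _) = cst 0); [exact: span_zero|apply/funext => x; rewrite big_ord0].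
rewrite (_ : (fun x => _) = fun x => F ord0 x + \sum_i F (lift ord0 i) x).
  by apply: span_add => //; exact: IH.
by apply/funext => x; rewrite big_ord_recl.
Qed.

Lemma differentiable_mul V (f g : V -> R) x : differentiable f x ->
  differentiable g x -> differentiable (fun y => f y * g y) x.
Proof. exact: differentiableM. Qed.

Lemma differentiable_add V W (f g : V -> W) x : differentiable f x ->
  differentiable g x -> differentiable (fun y => f y + g y) x.
Proof. exact: differentiableD. Qed.

Lemma derive_mul V (f g : V -> R) x v : differentiable f x ->
  differentiable g x ->
  'D_v (fun y => f y * g y) x = f x * 'D_v g x + 'D_v f x * g x.
Proof.
move=> df dg; have df' : derivable f x v by exact: diff_derivable.
have dg' : derivable g x v by exact: diff_derivable.
by have := deriveM df' dg'; rewrite /GRing.scale /= [g x * _]mulrC.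
Qed.

Lemma derive_add V W (f g : V -> W) x v : differentiable f x ->
  differentiable g x ->
  'D_v (fun y => f y + g y) x = 'D_v f x + 'D_v g x.
Proof. by move=> df dg; apply: deriveD; exact: diff_derivable. Qed.

(** It suffices to differentiate the generators: Leibniz handles the rest. *)
Lemma smooth_spanP V (D : set V) (G : (V -> R) -> Prop) : open D ->
  (forall f, G f -> forall x, D x -> differentiable f x) ->
  (forall f v, G f ->
     exists2 h, smooth_span D G h & forall x, D x -> 'D_v f x = h x) ->
  forall f, smooth_span D G f -> smooth_on D f.
Proof.
move=> oD Gd GD.
have spd f : smooth_span D G f -> forall x, D x -> differentiable f x.
  elim=> {f}[f Gf|||] => [x Dx|x _|a f sa sf df x Dx|f g sf df sg dg x Dx].
  - exact: Gd.
  - exact: differentiable_cst.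
  - by apply: differentiable_mul; [exact: (smooth_on_diff sa)|exact: df].
  - by apply: differentiable_add; [exact: df|exact: dg].
apply: smooth_on_coind => // f v; elim=> {f}[f Gf||a f sa sf [h sh fh]|f g sf [h sh fh] sg [k sk gk]].
- exact: GD.
- by exists (cst 0); [exact: span_zero|move=> x _; rewrite derive_cst].
- exists (fun x => a x * h x + 'D_v a x * f x).
    by apply: span_add; apply: span_mul => //; exact: smooth_on_derive.
  move=> x Dx; rewrite derive_mul ?fh //; first exact: (smooth_on_diff sa).
  exact: spd.
- exists (fun x => h x + k x); first exact: span_add.
  by move=> x Dx; rewrite derive_add ?fh ?gk //; exact: spd.
Qed.

Lemma smooth_span_smooth V (D : set V) f : open D ->
  smooth_span D (smooth_on D) f -> smooth_on D f.
Proof.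
move=> oD; apply: smooth_spanP => // [{}f sf x Dx|{}f v sf].
  exact: (smooth_on_diff sf).
exists (fun y => 'D_v f y) => //; apply: span_gen.
exact: smooth_on_derive.
Qed.

Lemma smooth_on_mul V (D : set V) (f g : V -> R) : open D ->
  smooth_on D f -> smooth_on D g -> smooth_on D (fun x => f x * g x).
Proof.
by move=> oD sf sg; apply: smooth_span_smooth => //; apply: span_mul => //; exact: span_gen.
Qed.

Lemma smooth_on_coord V k (D : set V) (f : V -> 'rV[R]_k) i : open D ->
  smooth_on D f -> smooth_on D (fun x => f x ord0 i : R).
Proof.
move=> oD sf.
have @L : {linear 'rV[R]_k -> R}.
  by exists (fun N : 'rV[R]_k => N ord0 i); do 2![eexists]; do ?[constructor];
     rewrite ?mxE// => ? *; rewrite ?mxE//; move=> ?; rewrite !mxE.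
by apply: (smooth_on_lin (L := L)) => //; exact: coord_continuous.
Qed.

Lemma row_sum_delta_fun V k (f : V -> 'rV[R]_k) :
  f = \sum_i (fun x => f x ord0 i *: delta_mx ord0 i).
Proof.
by apply/funext => x; rewrite fct_sumE {1}[f x]row_sum_delta.
Qed.

Lemma differentiable_row V k (f : V -> 'rV[R]_k) x :
  (forall i, differentiable (fun y => f y ord0 i : R) x) -> differentiable f x.
Proof.
move=> df; rewrite (row_sum_delta_fun f); apply: differentiable_sum => i.
exact: differentiableZl.
Qed.

Lemma differentiable_rowE V k (f : V -> 'rV[R]_k) x i :
  differentiable f x -> differentiable (fun y => f y ord0 i : R) x.
Proof.
move=> df; apply: (differentiable_comp df (g := fun N : 'rV[R]_k => N ord0 i)).
exact: differentiable_coord.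
Qed.

Lemma derive_row V k (f : V -> 'rV[R]_k) x v : differentiable f x ->
  'D_v f x = \row_i 'D_v (fun y => f y ord0 i : R) x.
Proof.
move=> df; rewrite derive_mx; last exact: diff_derivable.
by apply/rowP => i; rewrite !mxE.
Qed.

Lemma smooth_on_row V k (D : set V) (f : V -> 'rV[R]_k) : open D ->
  (forall i, smooth_on D (fun x => f x ord0 i : R)) -> smooth_on D f.
Proof.
move=> oD sf; apply: (@smooth_on_coind V 'rV[R]_k D
  (fun f => forall i, smooth_on D (fun x => f x ord0 i : R))) => //.
- move=> h sh x Dx; apply: differentiable_row => i; exact: (smooth_on_diff (sh i)).
- move=> h v sh; exists (fun y => 'D_v h y) => // i.
  have sd := smooth_on_derive v (sh i); apply: smooth_on_ext sd => // x Dx.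
  rewrite derive_row ?mxE // ; apply: differentiable_row => j.
  exact: (smooth_on_diff (sh j)).
Qed.

Lemma derive_lin V W (f : V -> W) x : differentiable f x ->
  forall a v w, 'D_(a *: v + w) f x = a *: 'D_v f x + 'D_w f x.
Proof. by move=> df a v w; rewrite !deriveE // linearP. Qed.

Lemma derive_comp V W W' (g : V -> W) (f : W -> W') x v :
  differentiable g x -> differentiable f (g x) ->
  'D_v (f \o g) x = 'D_('D_v g x) f (g x).
Proof.
move=> dg df; have dc : differentiable (f \o g) x by exact: differentiable_comp.
by rewrite (deriveE v dc) (deriveE v dg) (deriveE _ df) diff_comp.
Qed.

Lemma derive_row_sum W k (f : 'rV[R]_k -> W) x v : differentiable f x ->
  'D_v f x = \sum_i v ord0 i *: 'D_(delta_mx ord0 i) f x.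
Proof.
move=> df; rewrite deriveE // {1}[v]row_sum_delta linear_sum.
by apply: eq_bigr => i _; rewrite linearZ /= deriveE.
Qed.

Lemma smooth_on_comp_scalar V k (D : set V) (E : set 'rV[R]_k)
    (g : V -> 'rV[R]_k) (f : 'rV[R]_k -> R) : open D ->
  (forall x, D x -> E (g x)) -> smooth_on D g -> smooth_on E f ->
  smooth_on D (f \o g).
Proof.
move=> oD gDE sg sf.
apply: (smooth_spanP (G := fun h => exists2 f, smooth_on E f & h = f \o g)) => //.
- move=> _ [h sh ->] x Dx; apply: differentiable_comp.
    exact: (smooth_on_diff sg).
  by apply: (smooth_on_diff sh); exact: gDE.
- move=> _ v [h sh ->].
  exists (fun x => \sum_i ('D_v g x) ord0 i * ('D_(delta_mx ord0 i) h \o g) x).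
    apply: span_sum => i; apply: span_mul.
      by apply: smooth_on_coord => //; exact: smooth_on_derive.
    by apply: span_gen; exists ('D_(delta_mx ord0 i) h) => //; exact: smooth_on_derive.
  move=> x Dx; rewrite derive_comp.
  + by rewrite derive_row_sum //; apply: (smooth_on_diff sh); exact: gDE.
  + exact: (smooth_on_diff sg).
  + by apply: (smooth_on_diff sh); exact: gDE.
- by apply: span_gen; exists f.
Qed.

Lemma smooth_on_comp V k l (D : set V) (E : set 'rV[R]_k)
    (g : V -> 'rV[R]_k) (f : 'rV[R]_k -> 'rV[R]_l) : open D -> open E ->
  (forall x, D x -> E (g x)) -> smooth_on D g -> smooth_on E f ->
  smooth_on D (f \o g).
Proof.
move=> oD oE gDE sg sf; apply: smooth_on_row => // i.
apply: (smooth_on_comp_scalar (f := fun x => f x ord0 i) oD gDE sg).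
exact: smooth_on_coord.
Qed.

End Smooth.

(** * Second derivatives and a flat function *)

Lemma derive_scale (R : realType) (V W : normedModType R) (f : V -> W) x :
  differentiable f x -> forall a v, 'D_(a *: v) f x = a *: 'D_v f x.
Proof. by move=> df a v; rewrite !deriveE // linearZ. Qed.

Lemma is_derive_line (R : realType) (V W : normedModType R) (F : V -> W)
    (b w : V) (s : R) : differentiable F (b + s *: w) ->
  is_derive s 1 (fun s : R => F (b + s *: w)) ('D_w F (b + s *: w)).
Proof.
move=> dF.
have dp : is_diff s (fun s : R => b + s *: w) (0 + ( *:%R^~ w)).
  by apply: is_diffD.
have dp' : differentiable (fun s : R => b + s *: w) s by exact: ex_diff.
have dc : differentiable (F \o (fun s : R => b + s *: w)) s.
  by apply: differentiable_comp.
apply: DeriveDef; first exact: diff_derivable.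
rewrite [LHS](derive_comp (1 : R) dp' dF); congr (derive _ _ _).
by rewrite deriveE // diff_val /= !fctE /= add0r scale1r.
Qed.

Section Schwarz.
Context (R : realType) (V : normedModType R).

Definition second_difference (F : V -> R) (a x y : V) (h : R) : R :=
  h^-1 * h^-1 * (F (a + h *: x + h *: y) - F (a + h *: x) - F (a + h *: y) + F a).

(** The mean value theorem applied to the difference of [F] along two parallel
    segments leaves an increment of ['D_x F], which differentiability at [a]
    turns into a second derivative. *)
Lemma second_difference_cvg (F : V -> R) (a x y : V) :
  (\near a, differentiable F a) -> differentiable (fun z => 'D_x F z) a ->
  second_difference F a x y h @[h --> 0^'] --> 'D_y (fun z => 'D_x F z) a.
Proof.
set G : V -> R := fun z => 'D_x F z.
move=> dF dG; apply/cvgrPdist_le => e e0.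
pose M := 2 * `|x| + `|y| + 1.
have M0 : 0 < M by rewrite /M; have := normr_ge0 x; have := normr_ge0 y; lra.
have eM : 0 < e / M by rewrite divr_gt0.
have /diff_locally/eqaddoP/(_ _ eM) dG' := dG.
have [r r0 Hr] : exists2 r : R, 0 < r & forall k, `|k| < r ->
   differentiable F (a + k) /\ `|G (a + k) - G a - 'd G a k| <= e / M * `|k|.
  have dF' : \forall k \near (0 : V), differentiable F (a + k).
    move: dF; rewrite (near_shift 0) /=; apply: filterS => k /=.
    by rewrite subr0 addrC.
  have /nbhs_ballP[r r0 Hr] : \forall k \near (0 : V), differentiable F (a + k) /\
      `|(G \o shift a - (cst (G a) + 'd G a)) k| <= e / M * `|k|.
    exact: filterI dF' dG'.
  exists r => // k kr; have [|h1 h2] := Hr k.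
    by rewrite -ball_normE /ball_ /= sub0r normrN.
  split => //; move: h2; rewrite !fctE /=.
  by rewrite opprD addrA [k + a]addrC.
have rM : 0 < r / M by rewrite divr_gt0.
near=> h.
have h0 : h != 0 by near: h; exact: nbhs_dnbhs_neq.
have hr : `|h| < r / M.
  by near: h; apply: dnbhs0_lt.
have nb (c d : R) : 0 <= c <= 1 -> 0 <= d <= 1 ->
    `|c *: (h *: x) + d *: (h *: y)| <= `|h| * (`|x| + `|y|).
  move=> /andP[c0 c1] /andP[d0 d1]; apply: le_trans (ler_normD _ _) _.
  rewrite mulrDr !normrZ (ger0_norm c0) (ger0_norm d0).
  by apply: lerD; rewrite ler_piMl // mulr_ge0.
have nbr (c d : R) : 0 <= c <= 1 -> 0 <= d <= 1 ->
    `|c *: (h *: x) + d *: (h *: y)| < r.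
  move=> c01 d01; apply: le_lt_trans (nb c d c01 d01) _.
  have : `|h| * M < r by rewrite -ltr_pdivlMr.
  apply: le_lt_trans; apply: ler_wpM2l => //.
  by rewrite /M; have := normr_ge0 x; have := normr_ge0 y; lra.
(* The two parallel segments, parametrized by [0, 1] so that the sign of h is
   immaterial. *)
pose phi (s : R) := F (a + h *: y + s *: (h *: x)) - F (a + s *: (h *: x)).
pose dphi (s : R) := h * (G (a + h *: y + s *: (h *: x)) - G (a + s *: (h *: x))).
have d1 (s : R) : 0 <= s <= 1 -> differentiable F (a + h *: y + s *: (h *: x)).
  move=> s01; rewrite -addrA [h *: y + _]addrC -[h *: y]scale1r.
  by apply: (Hr _ _).1; apply: nbr => //; rewrite ler01 lexx.
have d2 (s : R) : 0 <= s <= 1 -> differentiable F (a + s *: (h *: x)).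
  move=> s01; rewrite -[s *: _]addr0 -(scale0r (h *: y)).
  by apply: (Hr _ _).1; apply: nbr => //; rewrite ler01 lexx.
have dphiP (s : R) : 0 <= s <= 1 -> is_derive s 1 phi (dphi s).
  move=> s01; rewrite /phi /dphi mulrBr.
  have H b : differentiable F (b + s *: (h *: x)) ->
     is_derive s 1 (fun s => F (b + s *: (h *: x))) (h * G (b + s *: (h *: x))).
    move=> dFb; have := is_derive_line dFb.
    by rewrite derive_scale.
  by apply: is_deriveB; apply: H; [exact: d1|exact: d2].
have [c c01 Hc] : exists2 c : R, c \in `]0, 1[ & phi 1 - phi 0 = dphi c * (1 - 0).
  apply: MVT => //.
    move=> s; rewrite in_itv /= => /andP[s0 s1]; apply: dphiP; rewrite !ltW //.
  apply: derivable_within_continuous => s; rewrite in_itv /= => s01.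
  by have [] := dphiP s s01.
have c01' : 0 <= c <= 1 by move: c01; rewrite in_itv /= => /andP[/ltW-> /ltW->].
have -> : second_difference F a x y h
    = h^-1 * (G (a + h *: y + c *: (h *: x)) - G (a + c *: (h *: x))).
  rewrite /second_difference; move: Hc; rewrite subr0 mulr1 /phi /dphi.
  rewrite !scale1r !scale0r !addr0 [a + h *: y + h *: x]addrAC => Hc.
  have -> : F (a + h *: x + h *: y) - F (a + h *: x) - F (a + h *: y) + F a
    = h * (G (a + h *: y + c *: (h *: x)) - G (a + c *: (h *: x))).
    by rewrite -Hc; ring.
  by field.
have i00 : 0 <= (0 : R) <= 1 by rewrite lexx ler01.
have i01 : 0 <= (1 : R) <= 1 by rewrite lexx ler01.
have [_ HB] := Hr _ (nbr c 1 c01' i01).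
have [_ HA] := Hr _ (nbr c 0 c01' i00).
move: HA HB; rewrite scale0r addr0 scale1r.
have -> : a + (c *: (h *: x) + h *: y) = a + h *: y + c *: (h *: x).
  by rewrite [c *: _ + _]addrC addrA.
set A := G (a + c *: _); set B := G (a + h *: y + _) => HA HB.
have dGy : 'D_y G a = 'd G a y by rewrite deriveE.
have dl : 'd G a (c *: (h *: x) + h *: y) = 'd G a (c *: (h *: x)) + h * 'd G a y.
  by rewrite linearD [in X in _ + X]linearZ.
have n1 : `|c *: (h *: x)| <= `|h| * (`|x|).
  rewrite !normrZ; move: c01' => /andP[c0 c1]; rewrite (ger0_norm c0).
  by rewrite ler_piMl // mulr_ge0.
have n2 := nb c 1 c01' i01; rewrite scale1r in n2.
rewrite dGy.
have hh : 0 < `|h| by rewrite normr_gt0.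
rewrite -(ler_pM2l hh) -normrM.
have -> : h * ('d G a y - h^-1 * (B - A)) = (A - G a - 'd G a (c *: (h *: x)))
   - (B - G a - 'd G a (c *: (h *: x) + h *: y)).
  by rewrite dl; field.
apply: le_trans (ler_normB _ _) _.
apply: le_trans (lerD HA HB) _.
rewrite -mulrDr; apply: (@le_trans _ _ (e / M * (`|h| * M))).
  apply: ler_wpM2l; first exact: ltW.
  apply: le_trans (lerD n1 n2) _.
  rewrite -mulrDr; apply: ler_wpM2l => //.
  by rewrite /M; have := normr_ge0 x; have := normr_ge0 y; lra.
by rewrite [`|h| * M]mulrC mulrA divfK ?gt_eqF // mulrC.
Unshelve. all: by end_near. Qed.

(** The second difference is symmetric in the two directions, and both mixed
    derivatives are its limit. *)
Lemma schwarz (F : V -> R) (a x y : V) :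
  (\near a, differentiable F a) -> differentiable (fun z => 'D_x F z) a ->
  differentiable (fun z => 'D_y F z) a ->
  'D_y (fun z => 'D_x F z) a = 'D_x (fun z => 'D_y F z) a.
Proof.
move=> dF dx dy.
have c1 := @second_difference_cvg F a x y dF dx.
have c2 := @second_difference_cvg F a y x dF dy.
rewrite (_ : second_difference F a y x = second_difference F a x y) in c2.
  exact: (cvg_unique _ c1 c2).
by apply/funext => h; rewrite /second_difference [a + _ + _]addrAC; ring.
Qed.

End Schwarz.

Section Bump.
Context (R : realType).

(** [flat k t] is [t^-k exp(-1/t)] for positive [t], extended by 0; the family
    is closed under differentiation up to linear combinations. *)
Definition flat (k : nat) (t : R) : R :=
  if 0 < t then t^-1 ^+ k * expR (- t^-1) else 0.

(** From [exp y >= (y / n) ^ n] with [y = 1/t] and [n = k + 1]. This is what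
    makes the difference quotient of [flat k] at 0, which is [flat k.+1],
    tend to 0. *)
Lemma flat_le k (t : R) : `|flat k t| <= k.+1%:R ^+ k.+1 * `|t|.
Proof.
rewrite /flat; case: ifPn => [t0|_]; last first.
  by rewrite normr0 mulr_ge0 ?exprn_ge0.
have ti0 : 0 < t^-1 by rewrite invr_gt0.
have ti0' := ltW ti0.
rewrite ger0_norm ?mulr_ge0 ?expR_ge0 ?exprn_ge0 // gtr0_norm //.
rewrite expRN ler_pdivrMr ?expR_gt0 //.
have k0 : 0 < k.+1%:R :> R by rewrite ltr0n.
have -> : t^-1 ^+ k = k.+1%:R ^+ k.+1 * t * (t^-1 / k.+1%:R) ^+ k.+1.
  rewrite expr_div_n [_ / _ ^+ k.+1]mulrC mulrACA divff ?expf_neq0 ?gt_eqF //.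
  by rewrite mul1r exprS mulrA divff ?mul1r ?gt_eqF.
apply: ler_wpM2l; first by rewrite mulr_ge0 ?exprn_ge0 // ltW.
have -> : expR t^-1 = expR (t^-1 / k.+1%:R) ^+ k.+1.
  by rewrite -expRM_natl -mulr_natl mulrCA divff ?mulr1 ?gt_eqF.
apply: lerXn2r; rewrite ?nnegrE ?expR_ge0 ?divr_ge0 //.
by apply: le_trans (expR_ge1Dx _); rewrite lerDr.
Qed.

Lemma is_derive_flat k (t : R) :
  is_derive t (1 : R) (flat k) (flat k.+2 t - k%:R * flat k.+1 t).
Proof.
have [t0|t0|t0] := ltgtP t 0.
- have -> : flat k.+2 t - k%:R * flat k.+1 t = 0.
    by rewrite /flat ltNge ltW //= mulr0 subrr.
  apply: (near_eq_is_derive (f := cst (0 : R))).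
  near=> s; rewrite /flat; have -> // : (0 < s) = false.
  by apply/negbTE; rewrite -leNgt ltW //; near: s; exact: lt_nbhsl.
- pose F (s : R) : R := s^-1 ^+ k * expR (- s^-1).
  apply: (@near_eq_is_derive R R R F (flat k) t 1).
    near=> s; rewrite /flat; have -> // : (0 < s) = true.
    by near: s; exact: lt_nbhsr.
  have tn0 : t != 0 by rewrite gt_eqF.
  have dV := is_deriveV tn0 (is_derive_id t (1 : R)).
  have dX := is_deriveX k dV.
  have dE := @is_derive1_comp R expR (- (fun s : R => s^-1)) t _ _
    (is_derive_expR (- t^-1)) (is_deriveN dV).
  have H := is_deriveM dX dE.
  have EF : F = (fun s => s^-1) ^+ k * (expR \o - (fun s => s^-1)).
    by apply/funext => s; rewrite /F [RHS]/(_ * _) /= exprfctE.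
  rewrite EF; apply: (is_derive_eq H).

  rewrite /flat t0 /GRing.scale /= !mulr1 -exprVn.
  rewrite !exprfctE /=; case: k {dX F H EF} => [|k] /=; last first.
    by rewrite !exprS; ring.
  by rewrite !mul0r expr0; ring.
- have -> : flat k.+2 t - k%:R * flat k.+1 t = 0.
    by rewrite /flat t0 ltxx mulr0 subrr.
  have H : h^-1 *: (flat k (h *: 1 + t) - flat k t) @[h --> 0^'] --> (0 : R).
    apply/cvgr0Pnorm_le => e e0.
    pose C : R := k.+2%:R ^+ k.+2.
    have C0 : 0 < C by rewrite exprn_gt0 // ltr0n.
    near=> h.
    have -> : h^-1 *: (flat k (h *: 1 + t) - flat k t) = flat k.+1 h.
      rewrite t0 addr0 /flat ltxx subr0 [h *: 1]mulr1.
      by case: ifP => _; [rewrite /GRing.scale /= mulrA -exprS|rewrite scaler0].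
    apply: le_trans (flat_le _ _) _; rewrite mulrC -ler_pdivlMr //.
    by near: h; apply: dnbhs0_le; rewrite divr_gt0.
  apply: DeriveDef; first by apply/cvg_ex; exists 0.
  exact: cvg_lim H.
Unshelve. all: by end_near. Qed.

Lemma smooth_on_flat (V : normedModType R) (D : set V) (q : V -> R) k :
  open D -> smooth_on D q -> smooth_on D (flat k \o q).
Proof.
move=> oD sq.
have df k' x : D x -> differentiable (flat k' \o q) x.
  move=> Dx; apply: differentiable_comp; first exact: (smooth_on_diff sq).
  by apply/derivable1_diffP; have [] := is_derive_flat k' (q x).
apply: (smooth_spanP (G := fun f => exists k, f = flat k \o q)) => //.
- by move=> _ [k' ->] x; exact: df.
- move=> _ v [k' ->].
  exists (fun x => 'D_v q x * ((flat k'.+2 \o q) x + - k'%:R * (flat k'.+1 \o q) x)).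
    apply: span_mul; first exact: smooth_on_derive.
    apply: span_add; first by apply: span_gen; exists k'.+2.
    by apply: span_mul; [exact: smooth_on_cst|apply: span_gen; exists k'.+1].
  move=> x Dx; have dq := smooth_on_diff sq Dx.
  have df1 : differentiable (flat k') (q x).
    by apply/derivable1_diffP; have [] := is_derive_flat k' (q x).
  rewrite derive_comp //= -['D_v q x]mulr1 derive_scale //.
  have [_ ->] := is_derive_flat k' (q x).
  by rewrite /GRing.scale /= mulr1 mulNr.
- by apply: span_gen; exists k.
Qed.

End Bump.

(** * Charts, coordinate fields and smooth vector fields *)

Section Charts.
Context (R : realType) (m : nat) (M : manifold R m).
Implicit Types (c d : chart R M m) (p q : M) (v w : 'rV[R]_m) (U : set M).

Local Notation atlas := (@atlas R m M).

Lemma cmapK c p : atlas c -> cdom c p -> cinv c (cmap c p) = p.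
Proof. by move=> /(@atlas_chart _ _ M)[_ _ + _ _]; exact. Qed.

Lemma cdom_open c : atlas c -> open (cdom c).
Proof. by move=> /(@atlas_chart _ _ M)[]. Qed.

Lemma chart_near c p U : atlas c -> cdom c p -> open_nbhs p U ->
  \forall y \near cmap c p,
    [/\ U (cinv c y), cdom c (cinv c y) & cmap c (cinv c y) = y].
Proof.
move=> ac cp [oU Up]; have [oc oi cK _ ci] := atlas_chart ac.
have : \forall y \near cmap c p, (U `&` cdom c) (cinv c y).
  apply: (ci p cp); rewrite cK //; apply: open_nbhs_nbhs; split => //.
  exact: openI.
have : \forall y \near cmap c p, (cmap c @` cdom c) y.
  by apply: open_nbhs_nbhs; split => //; exists p.
apply: filterS2 => y [q cq <-]; rewrite cK // => -[Uq _].
by split.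
Qed.

(** Charts are open maps; iterated derivatives are only meaningful on open
    sets, so every smoothness statement passes through this. *)
Lemma chart_image_open c U : atlas c -> open U -> open (cmap c @` (U `&` cdom c)).
Proof.
move=> ac oU; rewrite openE => _ [p [Up cp] <-].
have := chart_near ac cp (conj oU Up); apply: filterS => y [Uy cy <-].
by exists (cinv c y).
Qed.

Lemma transition_smooth c d : atlas c -> atlas d ->
  smooth_on (cmap c @` (cdom c `&` cdom d)) (cmap d \o cinv c).
Proof. exact: atlas_compat. Qed.

Lemma transition_diff c d p : atlas c -> atlas d -> cdom c p -> cdom d p ->
  differentiable (cmap d \o cinv c) (cmap c p).
Proof.
move=> ac ad cp dp; apply: (smooth_on_diff (transition_smooth ac ad)).
by exists p.
Qed.

Lemma chart_factor (W : normedModType R) (f : M -> W) c d p :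
  atlas c -> atlas d -> cdom c p -> cdom d p ->
  \forall y \near cmap d p,
    ((f \o cinv c) \o (cmap c \o cinv d)) y = (f \o cinv d) y.
Proof.
move=> ac ad cp dp.
have := chart_near ad dp (conj (cdom_open ac) cp).
by apply: filterS => y [cy dy _] /=; rewrite cmapK.
Qed.

Lemma diff_chart (W : normedModType R) (f : M -> W) c d p :
  atlas c -> atlas d -> cdom c p -> cdom d p ->
  differentiable (f \o cinv c) (cmap c p) ->
  differentiable (f \o cinv d) (cmap d p).
Proof.
move=> ac ad cp dp df; apply: near_eq_differentiable (chart_factor f ac ad cp dp) _.
apply: differentiable_comp; first exact: transition_diff.
by rewrite /= cmapK.
Qed.

Lemma derive_chart (W : normedModType R) (f : M -> W) c d p v :
  atlas c -> atlas d -> cdom c p -> cdom d p ->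
  differentiable (f \o cinv c) (cmap c p) ->
  'D_v (f \o cinv d) (cmap d p)
  = 'D_('D_v (cmap c \o cinv d) (cmap d p)) (f \o cinv c) (cmap c p).
Proof.
move=> ac ad cp dp df; rewrite -(near_eq_derive v (chart_factor f ac ad cp dp)).
rewrite derive_comp /= ?cmapK //; exact: transition_diff.
Qed.

Let at_atlas p : atlas (chart_at p) := chart_at_atlas p.
Let at_mem p : cdom (chart_at p) p := chart_at_mem p.
Hint Resolve at_atlas at_mem : core.

(** Read in the preferred chart; [mdiffP] moves it to any chart of the atlas. *)
Definition mdiff (W : normedModType R) (f : M -> W) p :=
  differentiable (f \o cinv (chart_at p)) (cmap (chart_at p) p).

Lemma mdiffP (W : normedModType R) (f : M -> W) c p : atlas c -> cdom c p ->
  mdiff f p <-> differentiable (f \o cinv c) (cmap c p).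
Proof. by move=> ac cp; split; apply: diff_chart. Qed.

Lemma near_chart c p U : atlas c -> cdom c p -> nbhs p U ->
  \forall y \near cmap c p, U (cinv c y).
Proof.
move=> ac cp; rewrite nbhsE => -[A [oA Ap] AU].
by have := chart_near ac cp (conj oA Ap); apply: filterS => y [/AU].
Qed.

Lemma near_eq_mdiff (W : normedModType R) (f g : M -> W) p :
  (\near p, f p = g p) -> mdiff f p -> mdiff g p.
Proof.
move=> fg; apply: near_eq_differentiable.
exact: (near_chart (U := fun p => f p = g p)).
Qed.

Lemma near_eq_dirder (W : normedModType R) (f g : M -> W) p v :
  (\near p, f p = g p) -> dirder f p v = dirder g p v.
Proof.
move=> fg; apply: near_eq_derive.
exact: (near_chart (U := fun p => f p = g p)).
Qed.

Lemma dirder_chart (W : normedModType R) (f : M -> W) c p v :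
  atlas c -> cdom c p -> mdiff f p ->
  dirder f p v = 'D_(tcoord c p v) (f \o cinv c) (cmap c p).
Proof.
by move=> ac cp /(mdiffP _ ac cp) df; rewrite /dirder (derive_chart v ac).
Qed.

Lemma mdiff_cmap c p : atlas c -> cdom c p -> mdiff (cmap c) p.
Proof. by move=> ac cp; exact: transition_diff. Qed.

Lemma dirderP (W : normedModType R) (f : M -> W) p : mdiff f p ->
  forall a v w, dirder f p (a *: v + w) = a *: dirder f p v + dirder f p w.
Proof. by move=> df a v w; exact: derive_lin. Qed.

Lemma tcoordP c p : atlas c -> cdom c p ->
  forall a v w, tcoord c p (a *: v + w) = a *: tcoord c p v + tcoord c p w.
Proof. by move=> ac cp; apply: dirderP; exact: mdiff_cmap. Qed.

Lemma tcoord_id c p v : atlas c -> cdom c p ->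
  'D_v (cmap c \o cinv c) (cmap c p) = v.
Proof.
move=> ac cp; rewrite (near_eq_derive (g := id)) ?derive_id //.
have := chart_near ac cp (conj (cdom_open ac) cp).
by apply: filterS => y [].
Qed.

Lemma tcoord_at p v : tcoord (chart_at p) p v = v.
Proof. exact: tcoord_id. Qed.

(** The chain rule for the three charts [c], [d] and the preferred one at
    [q]: the representation of tangent vectors drops out. *)
Lemma tcoord_cfield c d q w : atlas c -> atlas d -> cdom c q -> cdom d q ->
  tcoord d q (cfield c w q) = 'D_w (cmap d \o cinv c) (cmap c q).
Proof.
move=> ac ad cq dq; rewrite /tcoord /dirder /cfield [RHS](derive_chart w (at_atlas q)) //.
exact: transition_diff.
Qed.

Lemma cfieldK c q w : atlas c -> cdom c q -> tcoord c q (cfield c w q) = w.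
Proof. by move=> ac cq; rewrite tcoord_cfield // tcoord_id. Qed.

(** With [cfieldK]: components in [c] and coordinate fields of [c] are inverse
    to each other, which makes every tangent space a copy of R^m. *)
Lemma tcoordK c q v : atlas c -> cdom c q -> cfield c (tcoord c q v) q = v.
Proof.
move=> ac cq; rewrite /cfield -dirder_chart //; first exact: tcoord_at.
exact: mdiff_cmap.
Qed.

Lemma cfieldP c q : atlas c -> cdom c q ->
  forall a v w, cfield c (a *: v + w) q = a *: cfield c v q + cfield c w q.
Proof. by move=> ac cq; apply: derive_lin; exact: transition_diff. Qed.

Lemma cfield_sum c q k (a : 'I_k -> R) (v : 'I_k -> 'rV[R]_m) :
  atlas c -> cdom c q ->
  cfield c (\sum_i a i *: v i) q = \sum_i a i *: cfield c (v i) q.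
Proof.
move=> ac cq; have dt := transition_diff ac (at_atlas q) cq (at_mem q).
rewrite /cfield deriveE // linear_sum; apply: eq_bigr => i _.
by rewrite linearZ /= deriveE.
Qed.

Lemma dirder_cfield (W : normedModType R) (f : M -> W) c q w : atlas c ->
  cdom c q -> mdiff f q ->
  dirder f q (cfield c w q) = 'D_w (f \o cinv c) (cmap c q).
Proof. by move=> ac cq df; rewrite (dirder_chart _ ac) // cfieldK. Qed.

Lemma ext_at p v : ext p v p = v.
Proof. by rewrite -[LHS](tcoord_at p) cfieldK. Qed.

Remove Hints at_atlas at_mem : core.

Lemma ext0 p q : ext p 0 q = 0.
Proof. exact: derive0. Qed.

(** In a pair of charts the components of a coordinate field are a derivative
    of a transition map composed with another transition map. *)
Lemma cfield_smooth c w : atlas c -> vsmooth_on (cdom c) (cfield c w).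
Proof.
move=> ac c' d ac' ad.
set D := cmap c' @` _.
have oD : open D.
  rewrite /D -setIA [cdom c' `&` _]setIC setIA; apply: chart_image_open => //.
  by apply: openI; exact: cdom_open.
pose g := (fun y => 'D_w (cmap d \o cinv c) y) \o (cmap c \o cinv c').
apply: (smooth_on_ext (f := g)); [exact: oD| |].
  move=> _ [q [[cq c'q] dq] <-]; rewrite /g /= (cmapK ac' c'q).
  by rewrite (tcoord_cfield _ ac ad cq dq).
apply: (smooth_on_comp (E := cmap c @` (cdom c `&` cdom d))) => //.
- rewrite setIC; apply: chart_image_open => //; exact: cdom_open.
- move=> _ [q [[cq c'q] dq] <-] /=; rewrite cmapK //.
  by exists q.
- apply: smooth_on_sub (transition_smooth ac' ac) => _ [q [[cq c'q] dq] <-].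
  by exists q.
- by apply: smooth_on_derive; exact: transition_smooth.
Qed.

Lemma vsmooth_near_cfield c q w : atlas c -> cdom c q -> vsmooth_near q (cfield c w).
Proof.
move=> ac cq; exists (cdom c); last exact: cfield_smooth.
by split => //; exact: cdom_open.
Qed.

Lemma ext_smooth p v : vsmooth_near p (ext p v).
Proof. exact: (vsmooth_near_cfield v (at_atlas p) (at_mem p)). Qed.

Lemma vsmooth_sub U U' X : U `<=` U' -> @vsmooth_on R m M U' X -> vsmooth_on U X.
Proof.
move=> UU' sX c d ac ad; apply: smooth_on_sub (sX c d ac ad).
by apply: image_subset => q [[/UU' ? ?] ?].
Qed.

Lemma fsmooth_sub (W : normedModType R) U U' (f : M -> W) : U `<=` U' ->
  fsmooth_on U' f -> fsmooth_on U f.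
Proof.
move=> UU' sX c ac; apply: smooth_on_sub (sX c ac).
by apply: image_subset => q [/UU' ? ?].
Qed.

Let open2 c d U : atlas c -> atlas d -> open U ->
  open (cmap c @` (U `&` cdom c `&` (fun q : M => q) @^-1` cdom d)).
Proof.
move=> ac ad oU; rewrite -setIA [cdom c `&` _]setIC setIA.
by apply: chart_image_open => //; apply: openI => //; exact: cdom_open.
Qed.

Lemma vsmooth_ext U X Y : open U -> (forall q, U q -> X q = Y q) ->
  @vsmooth_on R m M U X -> vsmooth_on U Y.
Proof.
move=> oU XY sX c d ac ad; apply: smooth_on_ext (sX c d ac ad); first exact: open2.
by move=> _ [q [[Uq cq] dq] <-] /=; rewrite (cmapK ac cq) (XY q Uq).
Qed.

Lemma fsmooth_ext (W : normedModType R) U (f g : M -> W) : open U ->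
  (forall q, U q -> f q = g q) -> fsmooth_on U f -> fsmooth_on U g.
Proof.
move=> oU fg sf c ac; apply: smooth_on_ext (sf c ac); first exact: chart_image_open.
by move=> _ [q [Uq cq] <-] /=; rewrite (cmapK ac cq) (fg q Uq).
Qed.

Lemma fsmooth_cst (W : normedModType R) U (a : W) : open U ->
  fsmooth_on U (fun=> a : W).
Proof. by move=> oU c ac; apply: smooth_on_cst; exact: chart_image_open. Qed.

Lemma vsmooth_lin U (f : M -> R) X Y : open U -> fsmooth_on U (f : M -> R^o) ->
  vsmooth_on U X -> vsmooth_on U Y -> vsmooth_on U (fun q => f q *: X q + Y q).
Proof.
move=> oU sf sX sY c d ac ad; have oD := open2 ac ad oU.
set D := cmap c @` _ in oD *.
apply: (smooth_on_ext (f := fun y =>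
   f (cinv c y) *: tcoord d (cinv c y) (X (cinv c y))
   + tcoord d (cinv c y) (Y (cinv c y)))) => //.
  by move=> _ [q [[Uq cq] dq] <-] /=; rewrite (cmapK ac cq) (tcoordP ad dq).
have sf' : smooth_on D ((f \o cinv c) : _ -> R).
  by apply: smooth_on_sub (sf c ac) => _ [q [[Uq cq] dq] <-]; exists q.
apply: smooth_on_row => // i; apply: (smooth_on_ext (f := fun y =>
   f (cinv c y) * (tcoord d (cinv c y) (X (cinv c y))) ord0 i
   + (tcoord d (cinv c y) (Y (cinv c y))) ord0 i)) => //.
  by move=> y _; rewrite !mxE.
apply: smooth_span_smooth => //; apply: span_add; last first.
  by apply: span_gen; apply: (smooth_on_coord i oD (sY c d ac ad)).
apply: span_mul => //.
by apply: span_gen; apply: (smooth_on_coord i oD (sX c d ac ad)).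
Qed.

Lemma vsmooth_zero U : open U -> @vsmooth_on R m M U (fun=> 0).
Proof.
move=> oU c d ac ad; apply: (smooth_on_ext (f := cst 0)) => //.
- exact: open2.
- by move=> y _; rewrite /= /tcoord /dirder derive0.
- by apply: smooth_on_cst; exact: open2.
Qed.

Lemma fsmooth_mdiff (W : normedModType R) U (f : M -> W) p : open U -> U p ->
  fsmooth_on U f -> mdiff f p.
Proof.
by move=> oU Up sf; apply: (smooth_on_diff (sf _ (at_atlas p))); exists p.
Qed.

Lemma fsmooth_near_mdiff (f : M -> R) p : fsmooth_near p f -> mdiff f p.
Proof. by move=> [U [oU Up] sf]; exact: (fsmooth_mdiff oU Up sf). Qed.

Lemma vsmooth_near_lin p (f : M -> R) X Y : fsmooth_near p f ->
  vsmooth_near p X -> vsmooth_near p Y ->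
  vsmooth_near p (fun q => f q *: X q + Y q).
Proof.
move=> [U [oU Up] sf] [U1 [oU1 Up1] sX] [U2 [oU2 Up2] sY].
exists (U `&` (U1 `&` U2)).
  by split => //; do !apply: openI.
apply: vsmooth_lin; first by do !apply: openI.
- by apply: fsmooth_sub sf => q [].
- by apply: vsmooth_sub sX => q [_ []].
- by apply: vsmooth_sub sY => q [_ []].
Qed.

Lemma vsmooth_near_zero p : @vsmooth_near R m M p (fun=> 0).
Proof.
by exists setT; [split => //; exact: openT|apply: vsmooth_zero; exact: openT].
Qed.

Lemma vsmooth_nearZ p (f : M -> R) X : fsmooth_near p f ->
  vsmooth_near p X -> vsmooth_near p (fun q => f q *: X q).
Proof.
move=> sf sX; rewrite (_ : (fun _ => _) = fun q => f q *: X q + (fun=> 0) q).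
  exact: (vsmooth_near_lin sf sX (vsmooth_near_zero p)).
by apply/funext => q; rewrite addr0.
Qed.

Lemma fsmooth_near_cst p (a : R) : @fsmooth_near R m M p (fun=> a).
Proof.
by exists setT; [split => //; exact: openT|apply: fsmooth_cst; exact: openT].
Qed.

Lemma vsmooth_nearD p X Y :
  vsmooth_near p X -> vsmooth_near p Y -> @vsmooth_near R m M p (fun q => X q + Y q).
Proof.
move=> sX sY; rewrite (_ : (fun _ => _) = fun q => (fun=> 1) q *: X q + Y q).
  exact: (vsmooth_near_lin (fsmooth_near_cst p 1) sX sY).
by apply/funext => q; rewrite scale1r.
Qed.

Lemma vsmooth_near_eq p X Y : (\near p, X p = Y p) -> vsmooth_near p X ->
  @vsmooth_near R m M p Y.
Proof.
move=> XY; have : nbhs p (fun q => X q = Y q) := XY.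
rewrite nbhsE => -[A [oA Ap] AXY] [U [oU Up] sX].
exists (U `&` A); first by split => //; exact: openI.
apply: (@vsmooth_ext _ X); first exact: openI.
  by move=> q [_ /AXY].
by apply: vsmooth_sub sX => q [].
Qed.

End Charts.

(** * Connections and statistical structures of constant curvature *)

Lemma comb_sum (R : realType) (V W : lmodType R) (phi : V -> W) k
    (a : 'I_k -> R) (v : 'I_k -> V) :
  (forall a v w, phi (a *: v + w) = a *: phi v + phi w) ->
  phi (\sum_i a i *: v i) = \sum_i a i *: phi (v i).
Proof.
move=> phiP.
have phi0 : phi 0 = 0.
  by have := phiP (-1) 0 0; rewrite scaler0 addr0 scaleN1r addNr.
have : forall r, phi (\sum_(i <- r) a i *: v i) = \sum_(i <- r) a i *: phi (v i).
  by elim=> [|i r IH]; rewrite ?big_nil ?big_cons // phiP IH.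
exact.
Qed.

Lemma sub_swap (V : zmodType) (a b c d : V) : a - b = c - d -> a - c = b - d.
Proof.
by move=> /eqP; rewrite subr_eq => /eqP ->; rewrite addrAC [c - d]addrC addrK addrC.
Qed.

Section Connection.
Context (R : realType) (m : nat) (M : manifold R m) (nab : covder M).
Hypothesis nabP : affine_connection nab.
Implicit Types (p q : M) (v w : 'rV[R]_m).

Let at_open p : open_nbhs p (cdom (chart_at p)).
Proof.
by split; [apply: cdom_open; exact: chart_at_atlas|exact: chart_at_mem].
Qed.

Lemma conn_vec p a v w Y : vsmooth_near p Y ->
  nab p (a *: v + w) Y = a *: nab p v Y + nab p w Y.
Proof. by case: nabP => + _ _ _; apply. Qed.

Lemma conn_vec0 p Y : vsmooth_near p Y -> nab p 0 Y = 0.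
Proof.
by move=> sY; have := conn_vec (-1) 0 0 sY; rewrite scaler0 addr0 scaleN1r addNr.
Qed.

Lemma conn_add p v Y Z : vsmooth_near p Y -> vsmooth_near p Z ->
  nab p v (fun q => Y q + Z q) = nab p v Y + nab p v Z.
Proof. by case: nabP => _ + _ _; apply. Qed.

Lemma conn_leibniz p v f Y : fsmooth_near p f -> vsmooth_near p Y ->
  nab p v (fun q => f q *: Y q) = dirderR f p v *: Y p + f p *: nab p v Y.
Proof. by case: nabP => _ _ + _; apply. Qed.

Lemma dirderR_near_cst p (f : M -> R) a v : (\near p, f p = a) ->
  dirderR f p v = 0.
Proof.
move=> fa; rewrite /dirderR (near_eq_dirder (g := fun=> a : R^o)) //.
exact: derive_cst.
Qed.

Lemma conn_scale p v a Y : vsmooth_near p Y ->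
  nab p v (fun q => a *: Y q) = a *: nab p v Y.
Proof.
move=> sY; rewrite (conn_leibniz v (fsmooth_near_cst p a) sY).
rewrite (@dirderR_near_cst _ _ a) ?scale0r ?add0r //; exact: nearW.
Qed.

Lemma conn_zero p v : nab p v (fun=> 0) = 0.
Proof.
rewrite -[RHS](scale0r (nab p v (fun=> 0))) -(conn_scale v 0 (vsmooth_near_zero p)).
by congr (nab p v _); apply/funext => q; rewrite scaler0.
Qed.

(** The Leibniz rule for the indicator function of a neighbourhood makes a
    connection local. Coordinate fields are only linear in their coefficients
    inside the chart, so linearity in the field needs this. *)
Lemma conn_local p v Y Z : (\near p, Y p = Z p) -> vsmooth_near p Y ->
  nab p v Y = nab p v Z.
Proof.
move=> YZ sY; have sZ := vsmooth_near_eq YZ sY.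
have : nbhs p (fun q => Y q = Z q) := YZ.
rewrite nbhsE => -[A [oA Ap] AYZ].
pose f (q : M) : R := \1_A q.
have fA : \near p, f p = 1.
  have : nbhs p A by exact: open_nbhs_nbhs.
  by apply: filterS => q Aq; rewrite /f indicE mem_set.
have fp : f p = 1 by exact: nbhs_singleton fA.
have sf : fsmooth_near p f.
  exists A => //; apply: (@fsmooth_ext _ _ _ R^o _ (fun=> 1 : R^o)) => //.
    by move=> q Aq; rewrite /f indicE mem_set.
  exact: fsmooth_cst.
have E X : vsmooth_near p X -> nab p v (fun q => f q *: X q) = nab p v X.
  move=> sX; rewrite (conn_leibniz v sf sX) (dirderR_near_cst v fA).
  by rewrite scale0r add0r fp scale1r.
rewrite -(E Y sY) -(E Z sZ); congr (nab p v _); apply/funext => q.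
rewrite /f indicE; case: (boolP (q \in A)) => [|_]; last by rewrite !scale0r.
by rewrite inE => /AYZ ->.
Qed.

Lemma ext_lin p a v w :
  \forall q \near p, ext p (a *: v + w) q = a *: ext p v q + ext p w q.
Proof.
have : nbhs p (cdom (chart_at p)) by apply: open_nbhs_nbhs; exact: at_open.
by apply: filterS => q cq; apply: cfieldP => //; exact: chart_at_atlas.
Qed.

Lemma conn_ext_lin p x a v w :
  nab p x (ext p (a *: v + w)) = a *: nab p x (ext p v) + nab p x (ext p w).
Proof.
have E := conn_local x (@ext_lin p a v w) (ext_smooth p _).
have sv := ext_smooth p v; have sw := ext_smooth p w.
have D := conn_add x (vsmooth_nearZ (fsmooth_near_cst p a) sv) sw.
have S := conn_scale x a sv.
exact: (etrans E (etrans D (congr1 (fun t => t + nab p x (ext p w)) S))).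
Qed.

Lemma conn_smooth p X Y : vsmooth_near p X -> vsmooth_near p Y ->
  vsmooth_near p (fun q => nab q (X q) Y).
Proof.
move=> [U [oU Up] sX] [A [oA Ap] sY]; exists (U `&` A).
  by split => //; exact: openI.
case: nabP => _ _ _; apply; first exact: openI.
- by apply: vsmooth_sub sX => q [].
- by apply: vsmooth_sub sY => q [].
Qed.

Lemma lie_ext p x y : @lie R m M (ext p x) (ext p y) p = 0.
Proof.
have H v w : dirder (fun q => tcoord (chart_at p) q (ext p v q)) p w = 0.
  rewrite (near_eq_dirder (g := fun=> v)); first exact: derive_cst.
  have : nbhs p (cdom (chart_at p)).
    apply: open_nbhs_nbhs; split; [apply: cdom_open; exact: chart_at_atlas|].
    exact: chart_at_mem.
  by apply: filterS => q cq; rewrite cfieldK //; exact: chart_at_atlas.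
exact: (etrans (congr2 (fun a b => a - b) (H y (ext p x p)) (H x (ext p y p))) (subrr 0)).
Qed.

Lemma Rten_ext p x y z : Rten nab p x y z =
  nab p x (fun q => nab q (ext p y q) (ext p z))
  - nab p y (fun q => nab q (ext p x q) (ext p z)).
Proof.
rewrite /Rten /curvature lie_ext (conn_vec0 (ext_smooth p z)) subr0.
by rewrite !ext_at.
Qed.

(** Coordinate fields have constant components, hence second derivatives along
    them are second partial derivatives in the chart. *)
Lemma dirder_ext_sym p (F : M -> R) x y : fsmooth_near p F ->
  dirderR (fun q => dirderR F q (ext p y q)) p x
  = dirderR (fun q => dirderR F q (ext p x q)) p y.
Proof.
move=> [U [oU Up] sF].
pose c := chart_at p.
have ac : atlas c := chart_at_atlas p.
have cp : cdom c p := chart_at_mem p.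
have sFc := sF c ac.
have near_c : \forall y \near cmap c p, (cmap c @` (U `&` cdom c)) y.
  by apply: open_nbhs_nbhs; split; [exact: chart_image_open|exists p].
have E v w : dirderR (fun q => dirderR F q (ext p v q)) p w
   = 'D_w (fun z => 'D_v ((F : M -> R^o) \o cinv c) z) (cmap c p).
  apply: near_eq_derive; apply: filterS near_c => _ [q [Uq cq] <-] /=.
  rewrite cmapK // /dirderR dirder_cfield //.
  exact: (fsmooth_mdiff oU Uq sF).
apply: (etrans (E y x)); apply: (etrans _ (esym (E x y))).
apply: schwarz.
- apply: filterS near_c => z; exact: (smooth_on_diff sFc).
- by apply: (smooth_on_diff (smooth_on_derive y sFc)); exact: nbhs_singleton near_c.
- by apply: (smooth_on_diff (smooth_on_derive x sFc)); exact: nbhs_singleton near_c.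
Qed.

Lemma dirderR_add p (f g : M -> R) v : mdiff f p -> mdiff g p ->
  dirderR (fun q => f q + g q) p v = dirderR f p v + dirderR g p v.
Proof. by move=> df dg; rewrite /dirderR /dirder derive_add. Qed.

End Connection.

Section Metric.
Context (R : realType) (m : nat) (M : statManifold R m).
Implicit Types (p q : M) (v w x y z : 'rV[R]_m).

Local Notation g := (@met R m M).
Local Notation nb := (@nab R m M).
Local Notation cb := (@cnab R m M).
Local Notation lb := (@lc R m M).

Lemma metP p a v w z : g p (a *: v + w) z = a * g p v z + g p w z.
Proof. by have [+ _ _ _] := @met_riemannian R m M; apply. Qed.

Lemma metC p v w : g p v w = g p w v.
Proof. by have [_ + _ _] := @met_riemannian R m M; apply. Qed.

Lemma met_gt0 p v : v != 0 -> 0 < g p v v.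
Proof. by have [_ _ + _] := @met_riemannian R m M; apply. Qed.

Lemma met0l p z : g p 0 z = 0.
Proof. by have := metP p (-1) 0 0 z; rewrite scaler0 addr0 mulN1r addNr. Qed.
Lemma met0r p z : g p z 0 = 0. Proof. by rewrite metC met0l. Qed.
Lemma metDl p v w z : g p (v + w) z = g p v z + g p w z.
Proof. by rewrite -{1}[v]scale1r metP mul1r. Qed.
Lemma metZl p a v z : g p (a *: v) z = a * g p v z.
Proof. by rewrite -[a *: v]addr0 metP met0l addr0. Qed.
Lemma metNl p v z : g p (- v) z = - g p v z.
Proof. by rewrite -scaleN1r metZl mulN1r. Qed.
Lemma metBl p v w z : g p (v - w) z = g p v z - g p w z.
Proof. by rewrite metDl metNl. Qed.
Lemma metDr p v w z : g p z (v + w) = g p z v + g p z w.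
Proof. by rewrite !(metC p z) metDl. Qed.
Lemma metZr p a v z : g p z (a *: v) = a * g p z v.
Proof. by rewrite !(metC p z) metZl. Qed.
Lemma metNr p v z : g p z (- v) = - g p z v.
Proof. by rewrite !(metC p z) metNl. Qed.
Lemma metBr p v w z : g p z (v - w) = g p z v - g p z w.
Proof. by rewrite !(metC p z) metBl. Qed.
Lemma met_suml p k (v : 'I_k -> 'rV[R]_m) z :
  g p (\sum_i v i) z = \sum_i g p (v i) z.
Proof. by elim/big_rec2: _ => [|i a b _ <-]; rewrite ?met0l // metDl. Qed.
Lemma met_sumr p k (v : 'I_k -> 'rV[R]_m) z :
  g p z (\sum_i v i) = \sum_i g p z (v i).
Proof. by rewrite metC met_suml; apply: eq_bigr => i _; rewrite metC. Qed.

Lemma met_ge0 p v : 0 <= g p v v.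
Proof. by have [->|/(met_gt0 p)/ltW] := eqVneq v 0; rewrite ?met0l. Qed.

Lemma met_inj p v w : (forall z, g p v z = g p w z) -> v = w.
Proof.
move=> vw; apply/eqP; rewrite -subr_eq0; apply: contraT => /(met_gt0 p).
by rewrite metBl vw subrr ltxx.
Qed.

Definition metE := (metDl, metBl, metZl, metNl, met0l, metDr, metBr, metZr, metNr, met0r).

Lemma met_smooth p X Y : vsmooth_near p X -> vsmooth_near p Y ->
  fsmooth_near p (fun q => g q (X q) (Y q)).
Proof.
move=> [U [oU Up] sX] [A [oA Ap] sY]; exists (U `&` A).
  by split => //; exact: openI.
have [_ _ _] := @met_riemannian R m M; apply; first exact: openI.
- by apply: vsmooth_sub sX => q [].
- by apply: vsmooth_sub sY => q [].
Qed.

Lemma met_mdiff p X Y : vsmooth_near p X -> vsmooth_near p Y ->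
  mdiff (fun q => g q (X q) (Y q)) p.
Proof. by move=> sX sY; apply: fsmooth_near_mdiff; exact: met_smooth. Qed.

(** The cubic form of the statistical structure. *)
Definition cubic p x y z : R := g p (Kten p x y) z.

Lemma dirder_lc p v Y Z : vsmooth_near p Y -> vsmooth_near p Z ->
  dirderR (fun q => g q (Y q) (Z q)) p v
  = g p (lb p v Y) (Z p) + g p (Y p) (lb p v Z).
Proof.
move=> sY sZ; have := lc_metric v sY sZ; rewrite /nabla_metric => H.
by apply/eqP; rewrite -subr_eq0 opprD addrA H.
Qed.

Lemma Kten_sym p x y : Kten p x y = Kten (M := M) p y x.
Proof.
have H (D : covder M) : torsion_free D ->
    D p x (ext p y) - D p y (ext p x) = lie (ext p x) (ext p y) p.
  by move=> /(_ p _ _ (ext_smooth p x) (ext_smooth p y)); rewrite !ext_at.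
apply: sub_swap.
exact: (etrans (H _ (@nab_torsion_free R m M)) (esym (H _ (@lc_torsion_free R m M)))).
Qed.

Lemma nabE p x y : nb p x (ext p y) = lb p x (ext p y) + Kten p x y.
Proof. by rewrite /Kten addrC subrK. Qed.

(** Subtract the metric compatibility of the Levi-Civita connection. *)
Lemma nabla_metric_cubic p x y z :
  nabla_metric g nb p x (ext p y) (ext p z) = - cubic p x y z - cubic p x z y.
Proof.
rewrite /nabla_metric (dirder_lc x (ext_smooth p y) (ext_smooth p z)).
rewrite (ext_at p y) (ext_at p z) (nabE p x y) (nabE p x z) /cubic.
move: (Kten p x y) (Kten p x z) (lb p x _) (lb p x _) => k l a b.
by rewrite !metDl !metDr (metC p y l); ring.
Qed.

Lemma cubic12 p x y z : cubic p x y z = cubic p y x z.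
Proof. by rewrite /cubic Kten_sym. Qed.

(** The Codazzi equation, read on the cubic form: with [cubic12] it gives
    total symmetry. *)
Lemma cubic13 p x y z : cubic p x y z = cubic p z y x.
Proof.
have := nab_codazzi (ext_smooth p x) (ext_smooth p z) (ext_smooth p y).
rewrite (ext_at p x) (ext_at p z) (nabla_metric_cubic p x z y).
by rewrite (nabla_metric_cubic p z x y) (cubic12 p z x) => H; lra.
Qed.

Lemma cubic23 p x y z : cubic p x y z = cubic p x z y.
Proof. by rewrite (cubic12 p x y z) (cubic13 p y x z) (cubic12 p z x y). Qed.

(** The conjugate and the Levi-Civita product rules for the same function differ
    by the cubic form, whose total symmetry moves it to the other argument. *)
Lemma cnabE p x y : cb p x (ext p y) = lb p x (ext p y) - Kten p x y.
Proof.
apply: (@met_inj p) => z; rewrite metBl -/(cubic p x y z) (cubic23 p x y z).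
have := cnab_conjugate x (ext_smooth p z) (ext_smooth p y).
rewrite (dirder_lc x (ext_smooth p z) (ext_smooth p y)).
rewrite (ext_at p y) (ext_at p z) (nabE p x z) metDl -/(cubic p x z y).
by rewrite (metC p z (cb p x _)) (metC p z (lb p x _)) => H; lra.
Qed.

(** The conjugate connection differs from the Levi-Civita connection by the
    difference tensor, which enters once for each argument of the metric. *)
Lemma dirder_cnab p v y z :
  dirderR (fun q => g q (ext p y q) (ext p z q)) p v
  = g p (cb p v (ext p y)) z + g p y (cb p v (ext p z)) + 2 * cubic p v y z.
Proof.
have K1 : g p (Kten p v y) z = cubic p v y z by [].
have K2 : g p (Kten p v z) y = cubic p v y z := cubic23 p v z y.
have A := dirder_lc v (ext_smooth p y) (ext_smooth p z).
rewrite (ext_at p y) (ext_at p z) in A; apply: (etrans A).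
move: K1 K2 (cnabE p v y) (cnabE p v z) {A}.
move: (cubic p v y z) (Kten p v y) (Kten p v z) (cb p v (ext p y)) (cb p v (ext p z)).
move: (lb p v (ext p y)) (lb p v (ext p z)) => a b c k l a' b' <- + -> ->.
by rewrite metBl metBr (metC p l) => ->; ring.
Qed.

(** The linear algebra of [Rten_dual], over abstract vectors: [nxy] stands for
    the second derivative of [w] along x and y, [nx] for the first one along x,
    and [cxy], [cx] for those of [z] by the conjugate connection. *)
Lemma dual_swap p (nxy nyx nx ny cxy cyx cx cy w z : 'rV[R]_m) :
  g p nxy z + g p ny cx + (g p nx cy + g p w cxy)
  = g p nyx z + g p nx cy + (g p ny cx + g p w cyx) ->
  g p (cxy - cyx) w = - g p z (nxy - nyx).
Proof.
rewrite metBl metBr (metC p w cxy) (metC p w cyx) (metC p z nxy) (metC p z nyx).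
by move=> H; lra.
Qed.

(** Differentiate the function <W, Z> twice by the product rule for conjugate
    connections; antisymmetrized in the two directions, the left side vanishes
    and the mixed first-order terms cancel. *)
Lemma Rten_dual p x y z w :
  g p (Rten cb p x y z) w = - g p z (Rten nb p x y w).
Proof.
have sm v := ext_smooth p v.
have nP := @nab_connection R m M; have cP := @cnab_connection R m M.
pose F q := g q (ext p w q) (ext p z q).
have sF : fsmooth_near p F by apply: met_smooth; exact: sm.
have E a b : dirderR (fun q => dirderR F q (ext p b q)) p a =
   g p (nb p a (fun q => nb q (ext p b q) (ext p w))) z
   + g p (nb p b (ext p w)) (cb p a (ext p z))
   + (g p (nb p a (ext p w)) (cb p b (ext p z))
   + g p w (cb p a (fun q => cb q (ext p b q) (ext p z)))).
  have sn := conn_smooth nP (sm b) (sm w); have sc := conn_smooth cP (sm b) (sm z).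
  have N : \forall q \near p, dirderR F q (ext p b q)
      = g q (nb q (ext p b q) (ext p w)) (ext p z q)
      + g q (ext p w q) (cb q (ext p b q) (ext p z)).
    have oc : nbhs p (cdom (chart_at p)).
      apply: open_nbhs_nbhs; split; [apply: cdom_open; exact: chart_at_atlas|].
      exact: chart_at_mem.
    apply: filterS oc => q cq; apply: cnab_conjugate.
    + by apply: vsmooth_near_cfield => //; exact: chart_at_atlas.
    + by apply: vsmooth_near_cfield => //; exact: chart_at_atlas.
  have e1 := cnab_conjugate a sn (sm z).
  have e2 := cnab_conjugate a (sm w) sc.
  rewrite (ext_at p z) (ext_at p b) in e1; rewrite (ext_at p w) (ext_at p b) in e2.
  apply: (etrans (near_eq_dirder (W := R^o) a N)).
  apply: (etrans (dirderR_add a (met_mdiff sn (sm z)) (met_mdiff (sm w) sc))).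
  exact: (congr2 (fun s t => s + t) e1 e2).
rewrite (Rten_ext cP p x y z) (Rten_ext nP p x y w).
apply: dual_swap; exact: (etrans (esym (E x y)) (etrans (dirder_ext_sym x y sF) (E y x))).
Qed.

Section Curvature.
Variable lambda : R.
Hypothesis curv : constant_curvature M lambda.

(** The curvature tensor of a space of constant curvature. *)
Definition Rcst p x y z := lambda *: (g p y z *: x - g p x z *: y).

Lemma Rten_nab p x y z : Rten nb p x y z = Rcst p x y z.
Proof. exact: curv. Qed.

Lemma Rten_cnab p x y z : Rten cb p x y z = Rcst p x y z.
Proof.
apply: (@met_inj p) => w; rewrite Rten_dual Rten_nab /Rcst !metE.
by rewrite !(metC p z) (metC p x w) (metC p y w); ring.
Qed.

(** The defining equation of L for the curvature tensor [Rcst] is solved by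
    [Rcst] itself with the arguments renamed, thanks to its symmetries. *)
Lemma Lten_cst (D : covder M) p z w x :
  (forall x y z, Rten D p x y z = Rcst p x y z) ->
  Lten D p z w x = Rcst p z w x.
Proof.
move=> DR.
have H y : g p (Rcst p z w x) y = g p (Rten D p x y z) w.
  rewrite DR /Rcst !metE (metC p w x) (metC p z x) (metC p y z) (metC p y w).
  by ring.
apply: xget_unique => // l Hl; apply: (@met_inj p) => y.
by rewrite Hl H.
Qed.

Lemma nabla3_algebra p (x y z x' y' z' : 'rV[R]_m) (a b : R) :
  lambda *: ((g p y' z + g p y z' + 2 * a) *: x + g p y z *: x'
    + -1 *: ((g p x' z + g p x z' + 2 * b) *: y + g p x z *: y'))
  - Rcst p x' y z - Rcst p x y' z - Rcst p x y z'
  = (2 * lambda) *: (a *: x - b *: y).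
Proof. by apply/rowP => i; rewrite /Rcst !mxE; ring. Qed.

(** [Rcst] is built from the metric and identity maps only, so the Leibniz rule
    leaves the covariant derivative of the metric, twice the cubic form by
    [dirder_cnab]. *)
Lemma nabla3_cst p v x y z :
  nabla3 cb Rcst p v x y z
  = (2 * lambda) *: (cubic p v y z *: x - cubic p v x z *: y).
Proof.
have sm w := ext_smooth p w; have cP := @cnab_connection R m M.
have sg a b : fsmooth_near p (fun q => g q (ext p a q) (ext p b q)).
  by apply: met_smooth; exact: sm.
have sgv a b c : vsmooth_near p (fun q => g q (ext p a q) (ext p b q) *: ext p c q).
  exact: (vsmooth_nearZ (sg a b) (sm c)).
have sgm a b c : vsmooth_near p (fun q => -1 *: (g q (ext p a q) (ext p b q) *: ext p c q)).
  exact: (vsmooth_nearZ (fsmooth_near_cst p (-1)) (sgv a b c)).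
have -> : nabla3 cb Rcst p v x y z = cb p v (fun q => lambda *:
    (g q (ext p y q) (ext p z q) *: ext p x q
     + -1 *: (g q (ext p x q) (ext p z q) *: ext p y q)))
  - Rcst p (cb p v (ext p x)) y z - Rcst p x (cb p v (ext p y)) z
  - Rcst p x y (cb p v (ext p z)).
  rewrite /nabla3; congr (_ - _ - _ - _); congr (cb p v _); apply/funext => q.
  by rewrite /Rcst scaleN1r.
have D1 := conn_scale cP v lambda (vsmooth_nearD (sgv y z x) (sgm x z y)).
have D2 := conn_add cP v (sgv y z x) (sgm x z y).
have D3 := conn_scale cP v (-1) (sgv x z y).
have D4 := conn_leibniz cP v (sg y z) (sm x).
have D5 := conn_leibniz cP v (sg x z) (sm y).
rewrite (dirder_cnab p v y z) !ext_at in D4.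
rewrite (dirder_cnab p v x z) !ext_at in D5.
have D := etrans D1 (congr1 (fun t => lambda *: t) (etrans D2
  (congr2 (fun s t => s + t) D4 (etrans D3 (congr1 (fun t => -1 *: t) D5))))).
apply: etrans (nabla3_algebra _ _ _ _ _ _ _ _ _).
exact: (congr1 (fun t => t - Rcst p (cb p v (ext p x)) y z
  - Rcst p x (cb p v (ext p y)) z - Rcst p x y (cb p v (ext p z))) D).
Qed.

End Curvature.

End Metric.

(** * Sections of the pulled-back tangent bundle *)

Section SumRules.
Context (R : realType) (V : normedModType R).

Lemma differentiable_sumf k (F : 'I_k -> V -> R) x :
  (forall i, differentiable (F i) x) ->
  differentiable (fun y => \sum_i F i y) x.
Proof.
move=> dF; rewrite (_ : (fun y => _) = \sum_i F i); first exact: differentiable_sum.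
by apply/funext => y; rewrite fct_sumE.
Qed.

Lemma derive_sumf k (F : 'I_k -> V -> R) x v :
  (forall i, differentiable (F i) x) ->
  'D_v (fun y => \sum_i F i y) x = \sum_i 'D_v (F i) x.
Proof.
move=> dF; rewrite (_ : (fun y => _) = \sum_i F i).
  by apply: derive_sum => i; apply: diff_derivable; exact: dF.
by apply/funext => y; rewrite fct_sumE.
Qed.
End SumRules.

Section MapSections.
Context (R : realType) (m n : nat) (M : manifold R m) (N : statManifold R n).
Variable u : M -> N.
Hypothesis su : smooth_map u.
Implicit Types (p q : M) (v w : 'rV[R]_m).

Local Notation at_atlas p := (chart_at_atlas p).
Local Notation at_mem p := (chart_at_mem p).

Lemma smooth_map_near p (d : chart R N n) : atlas d -> cdom d (u p) ->
  nbhs p (fun q => cdom d (u q)).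
Proof.
move=> ad dp; have cu : {for p, continuous u} := su.1 p.
by apply: cu; apply: open_nbhs_nbhs; split => //; exact: cdom_open.
Qed.

Lemma smooth_map_diff p (d : chart R N n) : atlas d -> cdom d (u p) ->
  mdiff (cmap d \o u) p.
Proof.
move=> ad dp; apply: (smooth_on_diff (su.2 _ d (at_atlas p) ad)).
by exists p => //; split => //; exact: chart_at_mem.
Qed.

Lemma pullback_factor (W : normedModType R) (f : N -> W) p :
  \forall y \near cmap (chart_at p) p,
    ((f \o cinv (chart_at (u p))) \o (cmap (chart_at (u p)) \o u \o cinv (chart_at p))) y
    = ((f \o u) \o cinv (chart_at p)) y.
Proof.
have H := smooth_map_near (at_atlas (u p)) (at_mem (u p)).
have := near_chart (at_atlas p) (at_mem p) H.
apply: filterS => y dy /=; congr (f _); apply: cmapK dy; exact: chart_at_atlas.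
Qed.

Lemma pullback_mdiff (W : normedModType R) (f : N -> W) p :
  mdiff f (u p) -> mdiff (f \o u) p.
Proof.
move=> df; apply: (near_eq_differentiable (pullback_factor f p)).
apply: differentiable_comp.
  exact: (smooth_map_diff (at_atlas (u p)) (at_mem (u p))).
rewrite /= (cmapK (at_atlas p) (at_mem p)); exact: df.
Qed.

Lemma dirder_pullback (W : normedModType R) (f : N -> W) p v :
  mdiff f (u p) -> dirder (f \o u) p v = dirder f (u p) (tmap u p v).
Proof.
move=> df; apply: (etrans (esym (near_eq_derive v (pullback_factor f p)))).
have e : (cmap (chart_at (u p)) \o u \o cinv (chart_at p)) (cmap (chart_at p) p)
    = cmap (chart_at (u p)) (u p).
  by rewrite /= (cmapK (at_atlas p) (at_mem p)).
have du := smooth_map_diff (at_atlas (u p)) (at_mem (u p)).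
apply: (etrans (derive_comp v du _)); rewrite e //; exact: df.
Qed.

Lemma tcoord_tmap p (d : chart R N n) v : atlas d -> cdom d (u p) ->
  tcoord d (u p) (tmap u p v) = dirder (cmap d \o u) p v.
Proof.
by move=> ad dp; rewrite dirder_pullback //; exact: mdiff_cmap.
Qed.

(** In the preferred charts at [p] and [u p], the ones in which [pull] is
    computed. *)
Definition sdiff p (V : M -> 'rV[R]_n) :=
  mdiff (fun q => tcoord (chart_at (u p)) (u q) (V q)) p.

Lemma ssmooth_sdiff (V : M -> 'rV[R]_n) p : ssmooth_on u [set: M] V -> sdiff p V.
Proof.
move=> sV; apply: (smooth_on_diff (sV _ _ (at_atlas p) (at_atlas (u p)))).
exists p => //; split; last exact: chart_at_mem.
by split => //; exact: chart_at_mem.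
Qed.

(** The components of [u_* e] are the partial derivatives of [u] combined with
    the components of [e]. *)
Lemma tmap_sdiff p (e : M -> 'rV[R]_m) : vsmooth_near p e ->
  sdiff p (fun q => tmap u q (e q)).
Proof.
move=> [U [oU Up] se].
pose c := chart_at p; pose d := chart_at (u p).
have ac : atlas c := at_atlas p. have cp : cdom c p := at_mem p.
have ad : atlas d := at_atlas (u p). have dp : cdom d (u p) := at_mem (u p).
pose uh := cmap d \o u \o cinv c.
have suh := su.2 c d ac ad.
pose eh y := tcoord c (cinv c y) (e (cinv c y)).
have deh : differentiable eh (cmap c p).
  by apply: (smooth_on_diff (se c c ac ac)); exists p.
have mem : (cmap c @` (cdom c `&` u @^-1` cdom d)) (cmap c p) by exists p.
pose F y : 'rV[R]_n := \sum_j eh y ord0 j *: 'D_(delta_mx ord0 j) uh y.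
apply: (near_eq_differentiable (f := F)); last first.
  apply: differentiable_row => i.
  rewrite (_ : (fun y => _) = fun y => \sum_j (eh y ord0 j * ('D_(delta_mx ord0 j) uh y) ord0 i)).
    apply: differentiable_sumf => j; apply: differentiable_mul.
      exact: differentiable_rowE.
    apply: differentiable_rowE.
    exact: (smooth_on_diff (smooth_on_derive _ suh) mem).
  by apply/funext => y; rewrite /F summxE; apply: eq_bigr => j _; rewrite mxE.
have nd := near_chart ac cp (smooth_map_near ad dp).
have nc := chart_near ac cp (conj oU Up).
apply: filterS2 nd nc => y dy [Uy cy yE] /=.
rewrite (tcoord_tmap _ ad dy) (dirder_chart _ ac cy (smooth_map_diff ad dy)).
rewrite -/(eh y) yE derive_row_sum //.
by apply: (smooth_on_diff suh); exists (cinv c y).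
Qed.

Local Notation g := (@met R n N).

Lemma pull_algebra (y : N) k (a a' b b' : 'I_k -> R) (E P C : 'I_k -> 'rV[R]_n) :
  \sum_i \sum_j ((a i * b j) * (g y (P i) (E j) + g y (E i) (C j))
     + (a i * b' j + a' i * b j) * g y (E i) (E j))
  = g y (\sum_i a' i *: E i + \sum_i a i *: P i) (\sum_j b j *: E j)
    + g y (\sum_i a i *: E i) (\sum_j b' j *: E j + \sum_j b j *: C j).
Proof.
rewrite -!big_split /= !met_suml -big_split /=; apply: eq_bigr => i _.
rewrite !met_sumr -big_split /=; apply: eq_bigr => j _.
by rewrite metDl metDr !metZl !metZr; ring.
Qed.

(** Conjugate connections are dual along [u]: the product rule for the fibre
    metric of [u^{-1}TN]. It is checked in the coordinate frame. *)
Lemma pull_metric p v (V W : M -> 'rV[R]_n) : sdiff p V -> sdiff p W ->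
  mdiff (fun q => g (u q) (V q) (W q)) p /\
  dirderR (fun q => g (u q) (V q) (W q)) p v
  = g (u p) (pull (@nab R n N) u p v V) (W p)
    + g (u p) (V p) (pull (@cnab R n N) u p v W).
Proof.
move=> dV dW; pose d := chart_at (u p).
have ad : atlas d := at_atlas (u p). have dp : cdom d (u p) := at_mem (u p).
pose e_ i : 'rV[R]_n := delta_mx ord0 i.
(* Components in the coordinate frame of the preferred chart at [u p]. *)
pose Vh q := tcoord d (u q) (V q); pose Wh q := tcoord d (u q) (W q).
pose gam i j (y : N) : R := g y (cfield d (e_ i) y) (cfield d (e_ j) y).
pose F q : R := \sum_i \sum_j ((Vh q ord0 i * Wh q ord0 j) * gam i j (u q)).
have sE i : vsmooth_near (u p) (cfield d (e_ i)).
  exact: (vsmooth_near_cfield (e_ i) ad dp).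
have dgam i j : mdiff (gam i j) (u p) by exact: (met_mdiff (sE i) (sE j)).
have dgamu i j : mdiff (gam i j \o u) p by apply: pullback_mdiff; exact: dgam.
have dVi i : mdiff (fun q => Vh q ord0 i : R) p by exact: (differentiable_rowE i dV).
have dWi i : mdiff (fun q => Wh q ord0 i : R) p by exact: (differentiable_rowE i dW).
have dVW i j : mdiff (fun q => Vh q ord0 i * Wh q ord0 j) p.
  exact: (differentiable_mul (dVi i) (dWi j)).
have dF1 i j : mdiff (fun q => (Vh q ord0 i * Wh q ord0 j) * gam i j (u q)) p.
  exact: (differentiable_mul (dVW i j) (dgamu i j)).
have dF2 i : mdiff (fun q => \sum_j ((Vh q ord0 i * Wh q ord0 j) * gam i j (u q))) p.
  by apply: differentiable_sumf => j; exact: dF1.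
have dF : mdiff F p by apply: differentiable_sumf => i; exact: dF2.
have nF : \forall q \near p, F q = g (u q) (V q) (W q).
  apply: filterS (smooth_map_near ad dp) => q dq.
  have XE X : X = \sum_i tcoord d (u q) X ord0 i *: cfield d (e_ i) (u q).
    rewrite -{1}(tcoordK X ad dq) {1}[tcoord _ _ _]row_sum_delta.
    exact: (cfield_sum _ _ ad dq).
  rewrite [in RHS](XE (V q)) [in RHS](XE (W q)) met_suml; apply: eq_bigr => i _.
  rewrite met_sumr; apply: eq_bigr => j _.
  by rewrite metZl metZr mulrA.
split; first exact: (near_eq_mdiff nF dF).
apply: (etrans (esym (near_eq_dirder (W := R^o) v nF))).
pose w := tmap u p v.
pose P i := nab (u p) w (ext (u p) (e_ i)).
pose C i := cnab (u p) w (ext (u p) (e_ i)).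
pose a i : R := V p ord0 i. pose b i : R := W p ord0 i.
pose a' i : R := dirder Vh p v ord0 i. pose b' i : R := dirder Wh p v ord0 i.
have a'E i : dirderR (fun q => Vh q ord0 i : R) p v = a' i.
  have := congr1 (fun r : 'rV[R]_n => r ord0 i) (derive_row v dV).
  by rewrite mxE => /esym.
have b'E i : dirderR (fun q => Wh q ord0 i : R) p v = b' i.
  have := congr1 (fun r : 'rV[R]_n => r ord0 i) (derive_row v dW).
  by rewrite mxE => /esym.
have cK : cinv (chart_at p) (cmap (chart_at p) p) = p.
  exact: (cmapK (at_atlas p) (at_mem p)).
have Vp : Vh p = V p by exact: tcoord_at.
have Wp : Wh p = W p by exact: tcoord_at.
have gE i j : gam i j (u p) = g (u p) (e_ i) (e_ j).
  exact: (congr2 (g (u p)) (ext_at (u p) (e_ i)) (ext_at (u p) (e_ j))).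
have dgE i j : dirderR (gam i j \o u) p v
    = g (u p) (P i) (e_ j) + g (u p) (e_ i) (C j).
  apply: (etrans (dirder_pullback (W := R^o) v (dgam i j))).
  apply: (etrans (cnab_conjugate w (sE i) (sE j))).
  by rewrite -!/(ext _ _) !ext_at.
have dFE i j : dirderR (fun q => (Vh q ord0 i * Wh q ord0 j) * gam i j (u q)) p v
   = (a i * b j) * (g (u p) (P i) (e_ j) + g (u p) (e_ i) (C j))
     + (a i * b' j + a' i * b j) * g (u p) (e_ i) (e_ j).
  apply: (etrans (derive_mul _ (dVW i j) (dgamu i j))).
  rewrite /= cK Vp Wp gE; congr (_ * _ + _ * _); first exact: dgE.
  apply: (etrans (derive_mul _ (dVi i) (dWi j))).
  by rewrite /= cK Vp Wp; congr (_ * _ + _ * _); [exact: b'E|exact: a'E].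
have -> : dirder (F : M -> R^o) p v = \sum_i \sum_j
  ((a i * b j) * (g (u p) (P i) (e_ j) + g (u p) (e_ i) (C j))
     + (a i * b' j + a' i * b j) * g (u p) (e_ i) (e_ j)).
  apply: (etrans (derive_sumf _ dF2)); apply: eq_bigr => i _.
  apply: (etrans (derive_sumf _ (dF1 i))); apply: eq_bigr => j _.
  exact: dFE.
apply: (etrans (pull_algebra (u p) a a' b b' e_ P C)).
have rowE (x : 'rV[R]_n) : \sum_i x ord0 i *: e_ i = x by rewrite -row_sum_delta.
have cE (D : covder N) : affine_connection D ->
    forall x : 'rV[R]_n, \sum_i x ord0 i *: D (u p) w (ext (u p) (e_ i)) = D (u p) w (ext (u p) x).
  move=> aD x; pose phi x := D (u p) w (ext (u p) x).
  have phiP c s t : phi (c *: s + t) = c *: phi s + phi t by exact: (conn_ext_lin aD).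
  exact: (etrans (esym (comb_sum (fun i => x ord0 i) e_ phiP)) (congr1 phi (rowE x))).
have r1 : \sum_i a' i *: e_ i = dirder Vh p v := rowE _.
have r2 : \sum_i b' i *: e_ i = dirder Wh p v := rowE _.
have r3 : \sum_i a i *: e_ i = V p := rowE _.
have r4 : \sum_i b i *: e_ i = W p := rowE _.
have r5 : \sum_i a i *: P i = nab (u p) w (ext (u p) (V p)) := cE _ (@nab_connection R n N) (V p).
have r6 : \sum_i b i *: C i = cnab (u p) w (ext (u p) (W p)) := cE _ (@cnab_connection R n N) (W p).
exact: (congr2 (fun s t : R => s + t)
  (congr2 (g (u p)) (congr2 (fun s t => s + t) r1 r5) r4)
  (congr2 (g (u p)) r3 (congr2 (fun s t => s + t) r2 r6))).
Qed.

End MapSections.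

(** * Cut-off functions and global vector fields *)

Lemma smooth_on_id (R : realType) (V : normedModType R) (D : set V) :
  open D -> smooth_on D (id : V -> V).
Proof.
move=> oD; apply: (smooth_on_coind
  (P := fun f : V -> V => f = id \/ exists b, f = cst b)) => //.
- by move=> _ [->|[b ->]] x _; [exact: ex_diff|exact: differentiable_cst].
- move=> _ v [->|[b ->]].
    by exists (cst v); [right; exists v|move=> x _; rewrite derive_id].
  by exists (cst 0); [right; exists 0|move=> x _; rewrite derive_cst].
- by left.
Qed.

Section BumpRow.
Context (R : realType) (m : nat).

(** Normalized to 1 at the centre. The Euclidean ball of radius [r], outside
    which it vanishes, lies in the ball of the same radius for the sup norm. *)
Definition bump_row (a : 'rV[R]_m) (r : R) (x : 'rV[R]_m) : R :=
  flat 0 (r ^+ 2 - \sum_i (x ord0 i - a ord0 i) ^+ 2) / flat 0 (r ^+ 2).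

Lemma flat0_gt0 (t : R) : 0 < t -> 0 < flat 0 t.
Proof. by move=> t0; rewrite /flat t0 expr0 mul1r expR_gt0. Qed.

Lemma bump_row_center a r : 0 < r -> bump_row a r a = 1.
Proof.
move=> r0; rewrite /bump_row big1 ?subr0 ?divff //.
  by rewrite gt_eqF // flat0_gt0 // exprn_gt0.
by move=> i _; rewrite subrr expr0n.
Qed.

Lemma bump_row_out a r x : 0 < r -> r < `|x - a| -> bump_row a r x = 0.
Proof.
move=> r0 xa; rewrite /bump_row /flat; case: ifPn; last by rewrite mul0r.
rewrite subr_gt0 => H; exfalso; move: xa; apply/negP; rewrite -leNgt.
rewrite [leLHS]/Num.Def.normr /= mx_normrE; apply: bigmax_le; first exact: ltW.
move=> [i j] _ /=; rewrite !mxE (ord1 i).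
rewrite -(ler_pXn2r (n := 2)) ?nnegrE // ?(ltW r0) //.
rewrite real_normK ?num_real //; apply: le_trans (ltW H).
rewrite (bigD1 j) //= lerDl; apply: sumr_ge0 => k _.
exact: sqr_ge0.
Qed.

Lemma bump_row_smooth a r : smooth_on setT (bump_row a r).
Proof.
have oT : open [set: 'rV[R]_m] by exact: openT.
apply: (smooth_on_ext (f := fun x => (flat 0 (r ^+ 2))^-1 *
   (flat 0 \o (fun x : 'rV[R]_m => r ^+ 2 + \sum_i
      (- (x ord0 i - a ord0 i)) * (x ord0 i - a ord0 i))) x)) => //.
  move=> x _; rewrite /bump_row mulrC /=; congr (flat _ _ / _).
  by congr (_ + _); rewrite -sumrN; apply: eq_bigr => i _; rewrite expr2 mulNr.
apply: smooth_on_mul => //; first exact: smooth_on_cst.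
apply: smooth_on_flat => //.
have sxi i : smooth_on setT (fun x : 'rV[R]_m => x ord0 i - a ord0 i).
  apply: smooth_span_smooth => //; apply: span_add; apply: span_gen.
    apply: (smooth_on_coord (f := id)) => //; exact: smooth_on_id.
  exact: smooth_on_cst.
apply: smooth_span_smooth => //; apply: span_add.
  by apply: span_gen; exact: smooth_on_cst.
apply: span_sum => i; apply: span_mul; last exact: span_gen.
apply: (smooth_on_ext (f := fun x : 'rV[R]_m => cst (-1 : R) x * (x ord0 i - a ord0 i))) => //.
  by move=> x _; rewrite mulN1r.
by apply: smooth_on_mul => //; exact: smooth_on_cst.
Qed.

End BumpRow.

Section Extension.
Context (R : realType) (m : nat) (M : manifold R m).

(** A tangent vector is the value of a globally smooth vector field: cut off
    the coordinate field by a bump function. Hausdorffness makes the support,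
    a compact set, closed in [M]. *)
Lemma vector_extension (p : M) (v : 'rV[R]_m) :
  exists2 X : M -> 'rV[R]_m, vsmooth_on [set: M] X & X p = v.
Proof.
pose c := chart_at p.
have ac : atlas c := chart_at_atlas p. have cp : cdom c p := chart_at_mem p.
have [oc oi cK cc ci] := atlas_chart ac.
have : nbhs (cmap c p) (cmap c @` cdom c).
  by apply: open_nbhs_nbhs; split => //; exists p.
move=> /nbhs_ballP[e /= e0 eI].
pose r := e / 2; have r0 : 0 < r by rewrite divr_gt0.
pose B := [set x : 'rV[R]_m | `|x - cmap c p| <= r].
have BI : B `<=` cmap c @` cdom c.
  move=> x Bx; apply: eI; rewrite -ball_normE /ball_ /= distrC.
  by apply: le_lt_trans Bx _; rewrite /r ltr_pdivrMr // mulr_natr mulr2n ltrDl.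
have cB : compact B.
  apply: bounded_closed_compact.
    exists (`|cmap c p| + r); split; first exact: num_real.
    move=> z zr x Bx; apply: ltW; apply: le_lt_trans zr.
    by rewrite -[x](subrK (cmap c p)) addrC (le_trans (ler_normD _ _)) // lerD2l.
  have -> : B = closed_ball_ (@Num.Def.normr R _) (cmap c p) r.
    by apply/funext => x; rewrite /B /closed_ball_ /= distrC.
  exact: closed_closed_ball_.
pose K := cinv c @` B.
have cK' : compact K.
  apply: continuous_compact => //; apply: continuous_in_subspaceT => x.
  by rewrite inE => /BI[q cq <-]; exact: ci.
have clK : closed K by exact: compact_closed (@manifold_hausdorff _ _ M) cK'.
have KC : K `<=` cdom c by move=> _ [x /BI[q cq <-] <-]; rewrite cK.
pose X q := if q \in cdom c then bump_row (cmap c p) r (cmap c q) *: cfield c v q else 0.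
exists X; last first.
  rewrite /X mem_set // bump_row_center // scale1r; exact: ext_at.
(* The chart domain and the complement of [K] are open and cover [M]; the field
   is smooth on the first and zero on the second. *)
have XC : vsmooth_on (cdom c) X.
  apply: (@vsmooth_ext _ _ _ _ (fun q => bump_row (cmap c p) r (cmap c q) *: cfield c v q
    + (fun=> 0) q)) => //.
    by move=> q cq; rewrite /X mem_set // addr0.
  apply: vsmooth_lin => //; [|exact: cfield_smooth|exact: vsmooth_zero].
  move=> c' ac'.
  apply: (smooth_on_comp_scalar (E := setT) (f := bump_row (cmap c p) r)
    (g := cmap c \o cinv c')) => //.
  - exact: chart_image_open.
  - by rewrite setIC; exact: transition_smooth.
  - exact: bump_row_smooth.
have XK : vsmooth_on (~` K) X.
  apply: (@vsmooth_ext _ _ _ _ (fun=> 0)); first exact: closed_openC.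
    move=> q Kq; rewrite /X; case: ifPn => //; rewrite inE => cq.
    rewrite bump_row_out ?scale0r // ltNge; apply/negP => Bq.
    by apply: Kq; exists (cmap c q); rewrite ?cK.
  by apply: vsmooth_zero; exact: closed_openC.
move=> c' d ac' ad; apply: smooth_on_near => _ [q [[_ c'q] dq] <-].
have [U [oU Uq] sU] : exists2 U : set M, open U /\ U q & vsmooth_on U X.
  have [cq|ncq] := pselect (cdom c q); first by exists (cdom c).
  exists (~` K) => //; split; first exact: closed_openC.
  by move=> /KC.
exists (cmap c' @` (U `&` cdom c' `&` (fun q => q) @^-1` cdom d)); last exact: sU.
split; last by exists q.
rewrite -setIA [cdom c' `&` _]setIC setIA; apply: chart_image_open => //.
by apply: openI => //; exact: (cdom_open ad).
Qed.

End Extension.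

(** * The pairing of H with the tension field *)

Lemma sum_sub (V : zmodType) k (s l c : 'I_k -> V) :
  (forall i, s i = l i + c i) -> \sum_i c i = \sum_i s i - \sum_i l i.
Proof.
by move=> H; rewrite -sumrB; apply: eq_bigr => i _; rewrite H addrC addKr.
Qed.

Lemma sum_opp (V : zmodType) k (s d : 'I_k -> V) :
  (forall i, s i + d i = 0) -> \sum_i d i = - \sum_i s i.
Proof.
move=> H; rewrite -sumrN; apply: eq_bigr => i _.
by apply/eqP; rewrite -addr_eq0 addrC H.
Qed.

Section Pairing.
Context (R : realType) (m n : nat) (M : statManifold R m) (N : statManifold R n).
Variables (u : M -> N) (lambda : R).
Hypothesis su : smooth_map u.

Local Notation g := (@met R n N).
Local Notation nb := (@nab R n N).
Local Notation cb := (@cnab R n N).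

(** Either the chosen value is an orthonormal frame, smooth near [p], or it is
    the zero field. *)
Lemma frame_smooth (p : M) i : vsmooth_near p (frame p i).
Proof.
rewrite /frame; case: xgetP => [e _ [U oU [se _]]|_].
  by exists U.
exact: vsmooth_near_zero.
Qed.

(** The pairing of [Hop] with [t], over abstract vectors: [U i] for u_* e_i,
    [D i] for the conjugate derivative of [t] along e_i, and [A i], [B i] for
    the derivatives of the curvature tensor and of L. Each summand reduces to
    the component of [t] because [t] is orthogonal to the [U i]. *)
Lemma pairing_algebra (y : N) k (t c b2 : 'rV[R]_n) (U D A B : 'I_k -> 'rV[R]_n)
    (cu ca cb' : 'I_k -> R) :
  (forall i, g y (U i) t = 0) ->
  (forall i, A i = (2 * lambda) *: (cu i *: t - ca i *: U i)) ->
  (forall i, B i = (2 * lambda) *: (cu i *: t - cb' i *: U i)) ->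
  g y (Rcst lambda y t c t + \sum_i A i + 2 *: (\sum_i Rcst lambda y t (U i) (D i))
    + \sum_i B i - 2 *: (\sum_i Rcst lambda y (U i) t (D i)) - b2) t
  = 4 * lambda * g y t t * (\sum_i cu i + \sum_i g y (U i) (D i)) - g y b2 t.
Proof.
move=> Ut AE BE; rewrite 2!metBl 3!metDl 2!(metZl y 2 _ t) !met_suml.
have -> : g y (Rcst lambda y t c t) t = 0.
  by rewrite /Rcst metZl metBl !metZl (metC y c t); ring.
have -> : \sum_i g y (A i) t = 2 * lambda * g y t t * \sum_i cu i.
  rewrite mulr_sumr; apply: eq_bigr => i _.
  by rewrite AE metZl metBl !metZl Ut; ring.
have -> : \sum_i g y (B i) t = 2 * lambda * g y t t * \sum_i cu i.
  rewrite mulr_sumr; apply: eq_bigr => i _.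
  by rewrite BE metZl metBl !metZl Ut; ring.
have -> : \sum_i g y (Rcst lambda y t (U i) (D i)) t
    = lambda * g y t t * \sum_i g y (U i) (D i).
  rewrite mulr_sumr; apply: eq_bigr => i _.
  by rewrite /Rcst metZl metBl !metZl Ut; ring.
have -> : \sum_i g y (Rcst lambda y (U i) t (D i)) t
    = - (lambda * g y t t * \sum_i g y (U i) (D i)).
  rewrite mulr_sumr -sumrN; apply: eq_bigr => i _.
  by rewrite /Rcst metZl metBl !metZl Ut; ring.
by ring.
Qed.

Hypothesis curv : constant_curvature N lambda.

Lemma Rten_cnab_fun : Rten cb = Rcst lambda.
Proof.
apply/funext => p; apply/funext => x; apply/funext => y; apply/funext => z.
exact: Rten_cnab.
Qed.

Lemma Lten_cnab_fun : Lten cb = Rcst lambda.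
Proof.
apply/funext => p; apply/funext => z; apply/funext => w; apply/funext => x.
by apply: Lten_cst => *; exact: Rten_cnab.
Qed.

Lemma Lten_nab_fun : Lten nb = Rcst lambda.
Proof.
apply/funext => p; apply/funext => z; apply/funext => w; apply/funext => x.
by apply: Lten_cst => *; exact: curv.
Qed.

Hypothesis tau_smooth : ssmooth_on u [set: M] (tau u).
Hypothesis tau_normal : forall p v, g (u p) (tmap u p v) (tau u p) = 0.

(** Differentiating <u_* e_i, tau> = 0 turns the terms of [Hop] that contain the
    derivative of tau into - |tau|^2, and the trace of the cubic form along u
    measures the difference of the two tension fields. *)
Lemma Hop_tau (p : M) :
  g (u p) (Hop u (tau u) p) (tau u p)
  = - (4 * lambda * g (u p) (tau u p) (tau u p) * g (u p) (tau u p) (lctau u p)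
       + g (u p) (nabla2 cb (@Kten R n N) (u p) (tau u p) (tau u p) (tau u p))
           (tau u p)).
Proof.
pose t := tau u p; pose e := frame p; pose y := u p.
pose U i := tmap u p (e i p).
pose Uf i q := tmap u q (e i q).
pose D i := pull cb u p (e i p) (tau u).
pose S i := pull nb u p (e i p) (Uf i).
pose L i := pull (@lc R n N) u p (e i p) (Uf i).
have Ut i : g y (U i) t = 0 := tau_normal p (e i p).
(* The function <u_* e_i, t> vanishes near p, hence so does its derivative. *)
have UD i : g y (S i) t + g y (U i) (D i) = 0.
  have dU : sdiff u p (Uf i) := tmap_sdiff su (frame_smooth p i).
  have dt : sdiff u p (tau u) := ssmooth_sdiff p tau_smooth.
  have [_ H] := pull_metric su (e i p) dU dt.
  apply: (etrans (esym H)); apply: (@dirderR_near_cst _ _ _ _ _ 0).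
  by apply: nearW => q; exact: tau_normal.
(* The connection of N is its Levi-Civita connection plus K. *)
have SL i : g y (S i) t = g y (L i) t + cubic y (U i) (U i) t.
  rewrite -[RHS]metDl; congr (g y _ t).
  have H : forall s a b : 'rV[R]_n, s + a = s + b + (a - b).
    by move=> s a b; rewrite [a - b]addrC addrA addrK.
  exact: H.
have tS : g y t t = \sum_i g y (S i) t.
  apply: (etrans (met_suml y _ _)); apply: eq_bigr => i _.
  apply: (etrans (metBl y _ _ _)).
  exact: (etrans (congr2 (fun a b => a - b) (erefl (g y (S i) t)) (tau_normal p _)) (subr0 _)).
have tL : g y t (lctau u p) = \sum_i g y (L i) t.
  apply: (etrans (metC y t _)).
  apply: (etrans (met_suml y _ _)); apply: eq_bigr => i _.
  apply: (etrans (metBl y _ _ _)).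
  exact: (etrans (congr2 (fun a b => a - b) (erefl (g y (L i) t)) (tau_normal p _)) (subr0 _)).
have H := @pairing_algebra y m t (ctau u p) (nabla2 cb (@Kten R n N) y t t t) U D
   (fun i => nabla3 cb (Rcst lambda) y (U i) t (U i) t)
   (fun i => nabla3 cb (Rcst lambda) y t t (U i) (U i))
   (fun i => cubic y (U i) (U i) t) (fun i => cubic y (U i) t t)
   (fun i => cubic y t t (U i)) Ut (fun i => nabla3_cst lambda y (U i) t (U i) t).
have Hop_eq : Hop u (tau u) p = Rcst lambda y t (ctau u p) t
    + \sum_i nabla3 cb (Rcst lambda) y (U i) t (U i) t
    + 2 *: (\sum_i Rcst lambda y t (U i) (D i))
    + \sum_i nabla3 cb (Rcst lambda) y t t (U i) (U i)
    - 2 *: (\sum_i Rcst lambda y (U i) t (D i)) - nabla2 cb (@Kten R n N) y t t t.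
  by rewrite /Hop Rten_cnab_fun Lten_cnab_fun Lten_nab_fun.
have BE i : nabla3 cb (Rcst lambda) y t t (U i) (U i)
    = (2 * lambda) *: (cubic y (U i) (U i) t *: t - cubic y t t (U i) *: U i).
  apply: (etrans (nabla3_cst lambda y t t (U i) (U i))).
  by rewrite (cubic13 y t (U i) (U i)).
apply: (etrans (congr1 (fun s => g y s t) Hop_eq)); apply: (etrans (H BE)).
have C1 : \sum_i cubic y (U i) (U i) t = g y t t - g y t (lctau u p).
  exact: (etrans (sum_sub SL) (congr2 (fun a b => a - b) (esym tS) (esym tL))).
have C2 : \sum_i g y (U i) (D i) = - g y t t.
  exact: (etrans (sum_opp UD) (congr1 (fun a => - a) (esym tS))).
have final (a b c : R) : 4 * lambda * a * (a - b + - a) - c = - (4 * lambda * a * b + c).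
  by ring.
exact: (etrans (congr2 (fun s r => 4 * lambda * g y t t * (s + r)
   - g y (nabla2 cb (@Kten R n N) y t t t) t) C1 C2) (final _ _ _)).
Qed.

End Pairing.

(** A vector field through any given vector turns the normality of a section
    into a pointwise condition. *)
Lemma normal_pointwise (R : realType) (m n : nat) (M : statManifold R m)
    (N : statManifold R n) (u : M -> N) (V : M -> 'rV[R]_n) :
  (forall X : M -> 'rV[R]_m, vsmooth_on [set: M] X ->
     forall p : M, met (u p) (tmap u p (X p)) (V p) = 0) ->
  forall p v, met (u p) (tmap u p v) (V p) = 0.
Proof.
move=> H p v; have [X sX Xp] := vector_extension p v.
by have := H X sX p; rewrite Xp.
Qed.

(** * Integrals and the measure of open sets *)

Section IntegralBounds.
Context d (T : measurableType d) (R : realType).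
Variable mu : {measure set T -> \bar R}.
Local Open Scope ereal_scope.

Import HBNNSimple.

(** Simple functions below [a] on [E] are below [f] on [D]; comparing them
    bounds the integral of a function whose measurability is unknown. *)
Lemma integral_ge_on (D E : set T) (f : T -> R) (a : R) :
  (0 <= a)%R -> measurable E -> E `<=` D -> (forall x, D x -> (0 <= f x)%R) ->
  (forall x, E x -> (a <= f x)%R) ->
  a%:E * mu E <= \int[mu]_(x in D) (f x)%:E.
Proof.
move=> a0 mE ED f0 fa; rewrite -(integral_cst mu mE).
rewrite !ge0_integralE //; try by move=> x Dx; rewrite lee_fin ?f0.
apply: ereal_sup_le => _ [h /= hE <-].
exists h => // x; apply: le_trans (hE x) _.
rewrite /patch; case: ifPn => [|_].
  by rewrite inE => Ex; rewrite mem_set ?lee_fin ?fa //; exact: ED.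
by case: ifPn => //; rewrite inE => Dx; rewrite lee_fin f0.
Qed.

Lemma integral_lt0 (D E : set T) (f : T -> R) (a : R) :
  (0 < a)%R -> measurable E -> 0 < mu E -> E `<=` D ->
  (forall x, D x -> (f x <= 0)%R) -> (forall x, E x -> (f x <= - a)%R) ->
  \int[mu]_(x in D) (f x)%:E < 0.
Proof.
move=> a0 mE E0 ED f0 fa.
have -> : \int[mu]_(x in D) (f x)%:E = - \int[mu]_(x in D) (- f x)%:E.
  rewrite -integral_ge0N; last by move=> x Dx; rewrite lee_fin oppr_ge0 f0.
  by apply: eq_integral => x _; rewrite -EFinN opprK.
rewrite oppe_lt0; apply: lt_le_trans (integral_ge_on (ltW a0) mE ED _ _).
- by rewrite mule_gt0.
- by move=> x /f0; rewrite oppr_ge0.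
- by move=> x /fa; rewrite lerNr.
Qed.

End IntegralBounds.

(** A positive definite matrix is joined to the identity by a segment of
    invertible matrices, so the intermediate value theorem for the determinant
    along it fixes the sign. *)
Lemma posdef_det_gt0 (R : rcfType) k (G : 'M[R]_k) :
  (forall x : 'rV[R]_k, x != 0 -> 0 < (x *m G *m x^T) ord0 ord0) -> 0 < \det G.
Proof.
move=> Gpos.
pose P : 'M[{poly R}]_k := (1 - 'X)%:M + 'X *: map_mx polyC G.
have PE t : (\det P).[t] = \det ((1 - t)%:M + t *: G).
  rewrite -horner_evalE -det_map_mx; congr (\det _); apply/matrixP => i j.
  by rewrite !mxE /= horner_evalE; case: (i == j); rewrite ?mulr1n ?mulr0n !hornerE.
have sq (x : 'rV[R]_k) : x != 0 -> 0 < (x *m x^T) ord0 ord0.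
  move=> x0; rewrite mxE lt_def; apply/andP; split; last first.
    by apply: sumr_ge0 => i _; rewrite mxE -expr2 sqr_ge0.
  apply: contra x0 => /eqP H; apply/eqP/rowP => i; rewrite !mxE.
  have /(_ _ H)/(_ i isT)/eqP := psumr_eq0P (P := predT) (F := fun i => x ord0 i * x^T i ord0).
  rewrite mxE mulf_eq0 orbb => H'; apply/eqP/H' => j _.
  by rewrite mxE -expr2 sqr_ge0.
(* Along the segment the form stays definite, so the kernel stays trivial. *)
have nz t : 0 <= t <= 1 -> (\det P).[t] != 0.
  move=> /andP[t0 t1]; rewrite PE; apply/det0P => -[x x0 xA].
  have : (x *m ((1 - t)%:M + t *: G) *m x^T) ord0 ord0 = 0.
    by rewrite xA mul0mx mxE.
  rewrite mulmxDr mulmxDl mul_mx_scalar -scalemxAr -!scalemxAl.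
  have c0 := Gpos x x0; have b0 := sq x x0.
  rewrite mxE [X in X + _]mxE [X in _ + X]mxE.
  move: ((x *m x^T) _ _) ((x *m G *m x^T) _ _) b0 c0 => b c b0 c0 H.
  have h1 : 0 <= (1 - t) * b by rewrite mulr_ge0 ?(ltW b0) // subr_ge0.
  have h2 : 0 <= t * c by rewrite mulr_ge0 ?(ltW c0).
  have t0' : t = 0.
    apply/eqP; rewrite -(mulIr_eq0 _ (mulIf (lt0r_neq0 c0))); apply/eqP.
    by apply: le_anti; rewrite h2 andbT -H lerDr.
  by move: H; rewrite t0' subr0 mul1r mul0r addr0 => H; rewrite H ltxx in b0.
rewrite ltNge; apply/negP => G0.
have [] := @poly_ivt R (- \det P) 0 1 ler01.
  rewrite !hornerN !PE subr0 scale0r addr0 det1 subrr scale1r.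
  by rewrite oppr_le0 ler01 oppr_ge0 raddf0 add0r.
by move=> x x01; rewrite rootN /root (negbTE (nz x x01)).
Qed.

Section BoxMeasure.
Context (R : realType) (m : nat).
Variable leb : {measure set (borel 'rV[R]_m) -> \bar R}.
Hypothesis lebP : is_lebesgue leb.

Lemma borel_open (T : ptopologicalType) (U : set T) :
  open U -> measurable (U : set (borel T)).
Proof. by move=> oU; apply: sub_sigma_algebra. Qed.

Lemma borel_closed (T : ptopologicalType) (U : set T) :
  closed U -> measurable (U : set (borel T)).
Proof.
by move=> cU; rewrite -[U]setCK; apply: measurableC; apply: borel_open; exact: closed_openC.
Qed.

(** The balls of the sup norm are the boxes on which Lebesgue measure is
    prescribed. *)
Definition closed_cube (x : 'rV[R]_m) (r : R) := [set y : 'rV[R]_m | `|y - x| <= r].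

Lemma closed_cube_closed x r : closed (closed_cube x r).
Proof.
have -> : closed_cube x r = closed_ball_ (@Num.Def.normr R _) x r.
  by apply/funext => y; rewrite /closed_cube /closed_ball_ /= distrC.
exact: closed_closed_ball_.
Qed.

Lemma closed_cube_gt0 x r : 0 < r -> (0 < leb (closed_cube x r))%E.
Proof.
move=> r0.
pose a := \row_i (x ord0 i - r); pose b := \row_i (x ord0 i + r).
have -> : closed_cube x r = [set y : 'rV[R]_m | forall i, a ord0 i <= y ord0 i <= b ord0 i].
  apply/seteqP; split => y /=.
    rewrite /closed_cube /= [leLHS]/Num.Def.normr /= mx_normrE => yx i.
    rewrite !mxE lerBlDl -lerBlDl -ler_distl.
    apply: le_trans yx; apply: le_trans (le_bigmax _ _ (ord0, i)).
    by rewrite /= !mxE.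
  move=> H; rewrite /closed_cube /= [leLHS]/Num.Def.normr /= mx_normrE.
  apply: bigmax_le; first exact: ltW.
  move=> [i j] _ /=; rewrite (ord1 i) !mxE; have := H j; rewrite !mxE.
  by rewrite ler_distl.
rewrite (lebP (a := a) (b := b)); last by move=> i; rewrite !mxE; lra.
by rewrite lte_fin; apply: prodr_gt0 => i _; rewrite !mxE; lra.
Qed.

End BoxMeasure.

Section RiemannianMeasure.
Context (R : realType) (m : nat) (M : statManifold R m).
Variable mu : {measure set (borel M) -> \bar R}.
Hypothesis mu_g : is_riemannian_measure mu.

(** The Gram matrix represents the metric in the coordinate basis. *)
Lemma gram_det_gt0 (c : chart R M m) q : atlas c -> cdom c q -> 0 < \det (gram c q).
Proof.
move=> ac cq; apply: posdef_det_gt0 => x x0.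
have E : (x *m gram c q *m x^T) ord0 ord0 = met q (cfield c x q) (cfield c x q).
  have -> : cfield c x q = \sum_i x ord0 i *: cfield c (delta_mx ord0 i) q.
    by rewrite -(cfield_sum _ _ ac cq) -row_sum_delta.
  rewrite mxE met_sumr; apply: eq_bigr => j _.
  rewrite metZr met_suml mulrC !mxE; congr (_ * _); apply: eq_bigr => i _.
  by rewrite metZl mxE.
rewrite E; apply: met_gt0; apply: contra x0 => /eqP H.
by rewrite -(cfieldK x ac cq) H /tcoord /dirder derive0.
Qed.

Lemma gram_det_diff (c : chart R M m) q : atlas c -> cdom c q ->
  differentiable (fun y => \det (gram c (cinv c y)) : R) (cmap c q).
Proof.
move=> ac cq.
have dE i j : differentiable (fun y => gram c (cinv c y) i j : R) (cmap c q).
  have H : mdiff (fun p => gram c p i j) q.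
    apply: (near_eq_mdiff (f := fun p : M => (met p (cfield c (delta_mx ord0 i) p)
                       (cfield c (delta_mx ord0 j) p) : R^o))).
      by apply: nearW => p; rewrite mxE.
    apply: met_mdiff; exact: vsmooth_near_cfield.
  exact: (mdiffP _ ac cq).1 H.
rewrite /determinant.
have dprod (s : 'S_m) (r : seq 'I_m) : differentiable
    (fun y => \prod_(i <- r) gram c (cinv c y) i (s i) : R) (cmap c q).
  elim: r => [|i r IH].
    by under eq_fun do rewrite big_nil; exact: differentiable_cst.
  by under eq_fun do rewrite big_cons; exact: differentiable_mul.
have : forall r : seq 'S_m, differentiable (fun y => \sum_(s <- r) (-1) ^+ s *
    \prod_(i < m) gram c (cinv c y) i (s i) : R) (cmap c q).
  elim=> [|s r IH].
    by under eq_fun do rewrite big_nil; exact: differentiable_cst.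
  under eq_fun do rewrite big_cons; apply: differentiable_add => //.
  by apply: differentiable_mul; [exact: differentiable_cst|exact: dprod].
exact.
Qed.

(** In a chart the density is continuous and positive, so it is bounded below on
    a small cube, which has positive Lebesgue measure. *)
Lemma riemannian_measure_open (U : set M) p : open U -> U p ->
  (0 < mu (U : set (borel M)))%E.
Proof.
move=> oU Up; have [leb lebP muE] := mu_g.
pose c := chart_at p.
have ac : atlas c := chart_at_atlas p. have cp : cdom c p := chart_at_mem p.
pose A := U `&` cdom c.
have oA : open A by apply: openI => //; exact: cdom_open.
have mA : measurable (A : set (borel M)) by exact: borel_open.
suff : (0 < mu (A : set (borel M)))%E.
  move=> A0; apply: lt_le_trans A0 _; apply: le_measure.
  - by rewrite inE.
  - by rewrite inE; exact: borel_open.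
  - by move=> q [].
rewrite (muE c A ac mA); last by move=> q [].
pose f y := \det (gram c (cinv c y)).
have f0 : 0 < f (cmap c p) by rewrite /f cmapK //; exact: gram_det_gt0.
have fc : {for cmap c p, continuous (f : _ -> R)}.
  by apply: differentiable_continuous; exact: gram_det_diff.
have nf : \forall y \near cmap c p, f (cmap c p) / 2 < f y.
  have H : \forall z \near f (cmap c p), f (cmap c p) / 2 < z.
    by apply: lt_nbhsr; lra.
  exact: (fc _ H).
have nA : \forall y \near cmap c p, (cmap c @` A) y.
  apply: open_nbhs_nbhs; split; last by exists p.
  exact: chart_image_open.
have /nbhs_ballP[e /= e0 eI] : nbhs (cmap c p)
   [set y | f (cmap c p) / 2 < f y /\ (cmap c @` A) y].
  exact: filterI nf nA.
pose B := closed_cube (cmap c p) (e / 2).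
have e20 : 0 < e / 2 by rewrite divr_gt0.
have BI y : B y -> f (cmap c p) / 2 < f y /\ (cmap c @` A) y.
  move=> By; apply: eI; rewrite -ball_normE /ball_ /= distrC.
  by apply: le_lt_trans By _; lra.
pose a := Num.sqrt (f (cmap c p) / 2).
have a0 : 0 < a by rewrite sqrtr_gt0 divr_gt0.
have key : (a%:E * leb B <= \int[leb]_(x in (cmap c @` A : set (borel 'rV[R]_m)))
    (Num.sqrt (f x))%:E)%E.
  apply: integral_ge_on (ltW a0) _ _ _ _.
  - by apply: borel_closed; exact: closed_cube_closed.
  - by move=> y /BI[].
  - by move=> y _; exact: sqrtr_ge0.
  - by move=> y /BI[fy _]; apply: ler_wsqrtr; exact: ltW.
apply: lt_le_trans key; rewrite mule_gt0 ?lte_fin //.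
exact: (closed_cube_gt0 lebP).
Qed.

End RiemannianMeasure.

(** * Weak stability *)

Section HarmonicCase.
Context (R : realType) (m n : nat) (M : statManifold R m) (N : statManifold R n).
Variables (u : M -> N) (lambda : R).
Hypothesis curv : constant_curvature N lambda.
Hypothesis tau0 : forall p, tau u p = 0.

Local Notation cb := (@cnab R n N).

Lemma ext_zero (y : N) : ext y 0 = fun=> 0.
Proof. by apply/funext => q; rewrite ext0. Qed.

Lemma pull_zero (D : covder N) p v : affine_connection D ->
  pull D u p v (fun=> 0) = 0.
Proof.
move=> aD; rewrite /pull ext_zero (conn_zero aD) addr0.
rewrite (near_eq_dirder (g := fun=> 0)); first exact: derive_cst.
by apply: nearW => q; rewrite /tcoord /dirder derive0.
Qed.

Lemma Kten_zero2 (y : N) x : Kten y x 0 = 0.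
Proof.
rewrite /Kten ext_zero (conn_zero (@nab_connection R n N)).
by rewrite (conn_zero (@lc_connection R n N)) subrr.
Qed.

Lemma nabla2_zero (y : N) v : nabla2 cb (@Kten R n N) y v 0 0 = 0.
Proof.
have K0 x : Kten y 0 x = 0 by rewrite Kten_sym Kten_zero2.
rewrite /nabla2 ext_zero (_ : (fun q => _) = fun=> 0).
  by rewrite (conn_zero (@cnab_connection R n N)) Kten_zero2 subrr subr0.
by apply/funext => q; rewrite Kten_zero2.
Qed.

Lemma Rcst0 (y : N) x z : Rcst lambda y x z (0 : 'rV[R]_n) = 0.
Proof. by rewrite /Rcst !met0r !scale0r subrr scaler0. Qed.

Lemma Rcst0_mid (y : N) x z : Rcst lambda y x (0 : 'rV[R]_n) z = 0.
Proof. by rewrite /Rcst met0l scale0r scaler0 subrr scaler0. Qed.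

Lemma zero_combination k (T E : 'rV[R]_n) (A B C D : 'I_k -> 'rV[R]_n) :
  T = 0 -> (forall i, A i = 0) -> (forall i, B i = 0) -> (forall i, C i = 0) ->
  (forall i, D i = 0) -> E = 0 ->
  T + \sum_i A i + 2 *: (\sum_i B i) + \sum_i C i - 2 *: (\sum_i D i) - E = 0.
Proof.
move=> -> A0 B0 C0 D0 ->; rewrite !big1 //.
by rewrite scaler0 !addr0 !subr0.
Qed.

Lemma scaled_zero (a b c : R) (x y : 'rV[R]_n) : b = 0 -> c = 0 ->
  a *: (b *: x - c *: y) = 0.
Proof. by move=> -> ->; rewrite !scale0r subrr scaler0. Qed.

Lemma scaled_zero0 (a b c : R) (y : 'rV[R]_n) : c = 0 ->
  a *: (b *: 0 - c *: y) = 0.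
Proof. by move=> ->; rewrite scale0r scaler0 subrr scaler0. Qed.

(** Each term of [Hop] has the tension field as an argument. *)
Lemma Hop_zero (V : M -> 'rV[R]_n) p : Hop u V p = 0.
Proof.
have tauE : tau u = fun=> 0 by apply/funext.
have c0 (y : N) x z : cubic y x z 0 = 0 by exact: met0r.
rewrite /Hop (Rten_cnab_fun curv) (Lten_cnab_fun curv) (Lten_nab_fun curv) tauE.
apply: zero_combination => [|i|i|i|i|]; last exact: nabla2_zero.
- exact: Rcst0.
- apply: (etrans (nabla3_cst lambda _ _ _ _ _)); apply: scaled_zero; exact: c0.
- exact: (etrans (congr1 (Rcst lambda (u p) _ _) (pull_zero _ _ (@cnab_connection R n N))) (Rcst0 _ _ _)).
- apply: (etrans (nabla3_cst lambda _ _ _ _ _)); apply: scaled_zero0.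
  exact: (etrans (cubic23 _ _ _ _) (c0 _ _ _)).
- exact: Rcst0_mid.
Qed.

End HarmonicCase.

Theorem theorem5p2 (R : realType) (m n : nat)
    (M : statManifold R m) (N : statManifold R n)
    (mu : {measure set (borel M) -> \bar R})
    (u : M -> N) (lambda : R)
    (M_orientable : orientable M)
    (mu_g : is_riemannian_measure mu)
    (u_smooth : smooth_map u)
    (u_biharmonic : statistical_biharmonic u)
    (N_curvature : constant_curvature N lambda)
    (tau_compact : exists2 Omega : set M,
       relatively_compact_domain Omega & compact_section Omega u (tau u))
    (tau_jacobi : forall p : M,
       Lap u (tau u) p
       + \sum_(i < m) Rten (@nab R n N) (u p) (tau u p)
           (tmap u p (frame p i p)) (tmap u p (frame p i p))
       - 2 *: Kten (u p) (tau u p) (tau u p) = 0)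
    (tau_pinching : exists2 C : R, 0 < C & forall p : M,
       4 * lambda * met (u p) (tau u p) (tau u p)
         * met (u p) (tau u p) (lctau u p)
       + met (u p)
           (nabla2 (@cnab R n N) (@Kten R n N) (u p)
              (tau u p) (tau u p) (tau u p))
           (tau u p)
       >= C * met (u p) (tau u p) (tau u p) ^+ 2)
    (tau_normal : forall X : M -> 'rV[R]_m, vsmooth_on [set: M] X ->
       forall p : M, met (u p) (tmap u p (X p)) (tau u p) = 0) :
  weakly_stable mu u <-> (forall p : M, tau u p = 0).
Proof.
split; last first.
  move=> tau0 Omega V _ _.
  have -> : (\int[mu]_(p in (Omega : set (borel M)))
      (met (u p) (Hop u V p) (V p))%:E = 0)%E.
    apply: integral0_eq => p _; apply: (congr1 EFin).
    exact: (etrans (congr1 (fun h => met (u p) h (V p)) (Hop_zero N_curvature tau0 V p)) (met0l _ _)).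
  rewrite adde0; apply: integral_ge0 => p _; rewrite lee_fin; exact: met_ge0.
have [D domD tauO] := tau_compact; have [tau_smooth _ suppO] := tauO.
have [C C0 pinch] := tau_pinching.
move=> /(_ D (tau u) domD tauO).
have -> : (\int[mu]_(p in (D : set (borel M)))
    (met (u p) (jacobi u (tau u) p) (jacobi u (tau u) p))%:E = 0)%E.
  apply: integral0_eq => p _; apply: (congr1 EFin).
  exact: (etrans (congr1 (fun h => met (u p) h (jacobi u (tau u) p)) (tau_jacobi p)) (met0l _ _)).
rewrite add0e => stable p0; apply/eqP; apply: contraT => t0.
pose phi p := met (u p) (tau u p) (tau u p).
have HopE p : met (u p) (Hop u (tau u) p) (tau u p) <= - (C * phi p ^+ 2).
  apply: (le_trans (y := - _)); last by rewrite lerN2; exact: (pinch p).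
  by rewrite (Hop_tau u_smooth N_curvature tau_smooth (normal_pointwise tau_normal) p).
have phi0 : 0 < phi p0 by exact: met_gt0.
have Dp0 : D p0.
  by apply: suppO; apply: subset_closure.
have dphi : mdiff phi p0.
  have dt := ssmooth_sdiff p0 tau_smooth.
  by have [] := pull_metric u_smooth 0 dt dt.
have nphi : nbhs p0 (fun p => phi p0 / 2 < phi p).
  pose c := chart_at p0.
  have ac : atlas c := chart_at_atlas p0. have cp : cdom c p0 := chart_at_mem p0.
  have H1 : \forall y \near cmap c p0, phi p0 / 2 < (phi \o cinv c) y.
    have H : \forall z \near (phi \o cinv c) (cmap c p0), phi p0 / 2 < z.
      by apply: lt_nbhsr; rewrite /= (cmapK ac cp); lra.
    exact: (differentiable_continuous dphi H).
  have [_ _ _ cc _] := atlas_chart ac.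
  have H2 : \forall p \near p0, phi p0 / 2 < (phi \o cinv c) (cmap c p) := cc p0 cp _ H1.
  have H3 : nbhs p0 (cdom c).
    by apply: open_nbhs_nbhs; split => //; exact: cdom_open.
  by apply: filterS2 H2 H3 => p; rewrite /= => + cp'; rewrite (cmapK ac cp').
move: nphi; rewrite nbhsE => -[E [oE Ep0] Ephi].
have [_ oD _] := domD.
pose a := C * (phi p0 / 2) ^+ 2.
have a0 : 0 < a by rewrite mulr_gt0 // exprn_gt0 // divr_gt0.
have oED : open (E `&` D) by exact: openI.
pose B : set (borel M) := E `&` D.
have mB : measurable B by exact: borel_open.
have muB : (0 < mu B)%E by exact: (riemannian_measure_open mu_g oED (conj Ep0 Dp0)).
have BD : B `<=` D by move=> p [].
pose h (p : borel M) : R := met (u p) (Hop u (tau u) p) (tau u p).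
have h0 p : D p -> h p <= 0.
  move=> _; apply: le_trans (HopE p) _; rewrite oppr_le0.
  by rewrite mulr_ge0 ?(ltW C0) // sqr_ge0.
have mono (b z : R) : 0 < b -> b / 2 < z -> C * (b / 2) ^+ 2 <= C * z ^+ 2.
  move=> b0 bz; rewrite ler_pM2l // ler_pXn2r ?nnegrE //; lra.
have ha p : B p -> h p <= - a.
  move=> [/Ephi Hp _]; apply: le_trans (HopE p) _; rewrite lerN2.
  exact: (mono _ _ phi0 Hp).
have := le_lt_trans stable (integral_lt0 a0 mB muB BD h0 ha).
by rewrite ltxx.
Qed.
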